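(* Let $s\in(0,1)$ and $p>2$. Let $u\in C^3_{\mathrm{loc}}(\mathbb{R}^n)\cap L_{sp}(\mathbb{R}^n)$ with $|\nabla u|\in L_{sp}(\mathbb{R}^n)$. If $p>\frac{3}{2-s}$, then $(-\triangle)_p^s u\in C^1(\mathbb{R}^n)$.
   Context: The fractional $p$-Laplacian is $$(-\triangle)_p^s u(x):=C_{n,s,p}\lim_{\epsilon\to0}\int_{\mathbb{R}^n\setminus B_\epsilon(x)}\frac{|u(x)-u(y)|^{p-2}(u(x)-u(y))}{|x-y|^{n+sp}}\,dy,$$ where $C_{n,s,p}>0$ is a constant depending only on $n,s,p$. The space $L_{sp}(\mathbb{R}^n)$ is $$L_{sp}(\mathbb{R}^n):=\left\{u\in L^1_{\mathrm{loc}}(\mathbb{R}^n)\ \Big|\ \int_{\mathbb{R}^n}\frac{|u(x)|^{p-1}}{(1+|x|)^{n+sp}}\,dx<\infty\right\}.$$ *)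

(* Defs.v *)
From HB Require Import structures.
From mathcomp Require Export all_boot all_order all_algebra.
From mathcomp Require Export all_classical all_reals all_analysis.

Set Implicit Arguments.
Unset Strict Implicit.
Unset Printing Implicit Defensive.

Export Order.TTheory GRing.Theory Num.Theory.
Export numFieldNormedType.Exports.

Local Open Scope classical_set_scope.
Local Open Scope ring_scope.

(* The norm that the library puts on 'rV[R]_n is the sup norm. It induces the
   topology of R^n, but the modulus in the kernels below is Euclidean. *)
Definition enorm (R : realType) (n : nat) (x : 'rV[R]_n) : R :=
  Num.sqrt (\sum_(i < n) x ord0 i ^+ 2).

Definition eball (R : realType) (n : nat) (x : 'rV[R]_n) (r : R) :
    set 'rV[R]_n := [set y | enorm (y - x) < r].

Definition measure_rV_display : measure_display -> measure_display.
Proof. exact. Qed.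

(* The sigma-algebra of R^n is the product one; it contains every open set
   (open_measurable_rV), hence it is the Borel sigma-algebra. *)
Section measurable_rV.
Context {R : realType} (n : nat).

Let coors : 'I_n -> 'rV[R]_n -> R := fun i x => x ord0 i.

Let rV_set0 : g_sigma_preimage coors set0.
Proof. exact: sigma_algebra0. Qed.

Let rV_setC A : g_sigma_preimage coors A -> g_sigma_preimage coors (~` A).
Proof. exact: sigma_algebraC. Qed.

Let rV_bigcup (F : (set 'rV[R]_n)^nat) :
  (forall i, g_sigma_preimage coors (F i)) ->
  g_sigma_preimage coors (\bigcup_i (F i)).
Proof. exact: sigma_algebra_bigcup. Qed.

HB.instance Definition _ :=
  @isMeasurable.Build (measure_rV_display default_measure_display)
    'rV[R]_n (g_sigma_preimage coors) rV_set0 rV_setC rV_bigcup.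

End measurable_rV.

Lemma measurable_coord_rV (R : realType) n (i : 'I_n) :
  measurable_fun [set: 'rV[R]_n] (fun x : 'rV[R]_n => x ord0 i).
Proof.
move=> _ Y mY; rewrite setTI; apply: sub_sigma_algebra => /=.
rewrite -bigcup_seq/=; exists i => /=; first by rewrite mem_index_enum.
by exists Y => //; rewrite setTI.
Qed.

Lemma measurable_fun_rVP (R : realType) d (T : measurableType d) n
    (f : T -> 'rV[R]_n) :
  (forall i, measurable_fun [set: T] (fun t => f t ord0 i)) ->
  measurable_fun [set: T] f.
Proof.
move=> mf.
suff prefS : g_sigma_preimage (fun i t => f t ord0 i) `<=` @measurable _ T.
  move=> _ A mA; rewrite setTI; apply: prefS.
  rewrite (@g_sigma_preimage_comp _ _ n _ (fun i (x : 'rV[R]_n) => x ord0 i) _ f).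
  by exists A => //; rewrite setTI.
apply: smallest_sub; first exact: sigma_algebra_measurable.
case: n => [|n] in f mf *; first by rewrite big_ord0.
rewrite -bigcup_mkord_ord; apply: bigcup_sub => i Ii.
by move=> A [B mB <-]; exact: mf.
Qed.

Lemma open_measurable_rV (R : realType) n (U : set 'rV[R]_n) :
  open U -> measurable U.
Proof.
move=> oU.
pose box (q : {ffun 'I_n -> rat * rat}) :=
  [set x : 'rV[R]_n | forall i, x ord0 i \in `]ratr (q i).1, ratr (q i).2[].
have -> : U = \bigcup_q (if `[< box q `<=` U >] then box q else set0).
  apply/seteqP; split => [x Ux|x [q _]]; last by case: asboolP => // + ?; apply.
  have /nbhs_ballP[e /= e0 xeU] : nbhs x U by exact: open_nbhs_nbhs.
  have /choice[f fP] : forall i, exists ab : rat * rat,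
      (ratr ab.1 \in `]x ord0 i - e, x ord0 i[) &&
      (ratr ab.2 \in `]x ord0 i, x ord0 i + e[).
    move=> i.
    have [|a aP] := @rat_in_itvoo R (x ord0 i - e) (x ord0 i).
      by rewrite ltrBlDr ltrDl.
    have [|b bP] := @rat_in_itvoo R (x ord0 i) (x ord0 i + e).
      by rewrite ltrDl.
    by exists (a, b); rewrite aP bP.
  exists [ffun i => f i] => //; case: asboolP => [_ i|[]].
    rewrite ffunE in_itv/=; have /andP[] := fP i.
    by rewrite !in_itv/= => /andP[_ ->] /andP[->].
  move=> y yq; apply: xeU; split => // j i; rewrite ord1 /ball/=.
  have := yq i; have /andP[] := fP i.
  rewrite ffunE !in_itv/= => /andP[a1 a2] /andP[b1 b2] /andP[y1 y2].
  rewrite ltr_norml; apply/andP; split.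
    by rewrite ltrBrDl ltrBlDr (lt_trans y2).
  by rewrite ltrBlDr addrC -ltrBlDr (lt_trans a1).
apply: countable_bigcupT_measurable => // q.
case: ifPn => // _.
rewrite (_ : box q = \bigcap_(i in setT)
    [set x : 'rV[R]_n | x ord0 i \in `]ratr (q i).1, ratr (q i).2[]).
  apply: fin_bigcap_measurable => // i _.
  rewrite -[X in measurable X]setTI.
  exact: (@measurable_coord_rV R n i measurableT _ (measurable_itv _)).
by apply/seteqP; split => [x qx i _|x qx i]; [exact: qx|exact: (qx i I)].
Qed.

Definition cons_rV (R : realType) (n : nat) (z : R * 'rV[R]_n) : 'rV[R]_n.+1 :=
  \row_i oapp (z.2 ord0) z.1 (unlift ord0 i).

Definition uncons_rV (R : realType) (n : nat) (x : 'rV[R]_n.+1) :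
    R * 'rV[R]_n :=
  (x ord0 ord0, \row_i x ord0 (lift ord0 i)).

Lemma cons_rVK (R : realType) n : cancel (@cons_rV R n) (@uncons_rV R n).
Proof.
move=> [a x]; rewrite /uncons_rV mxE unlift_none/=; congr pair.
by apply/rowP => i; rewrite !mxE liftK.
Qed.

Lemma uncons_rVK (R : realType) n : cancel (@uncons_rV R n) (@cons_rV R n).
Proof.
move=> x; apply/rowP => i; rewrite mxE.
by case: unliftP => [j|] -> //=; rewrite mxE.
Qed.

Lemma measurable_cons_rV (R : realType) n :
  measurable_fun [set: R * 'rV[R]_n] (@cons_rV R n).
Proof.
apply: measurable_fun_rVP => i; under eq_fun do rewrite mxE.
case: (unlift ord0 i) => [j|] /=; last exact: measurable_fst.
exact: (measurableT_comp (@measurable_coord_rV R n j)).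
Qed.

Lemma measurable_uncons_rV (R : realType) n :
  measurable_fun [set: 'rV[R]_n.+1] (@uncons_rV R n).
Proof.
apply: measurable_fun_pair; first exact: measurable_coord_rV.
apply: measurable_fun_rVP => i; under eq_fun do rewrite mxE.
exact: measurable_coord_rV.
Qed.

(* Lebesgue measure on R^n, by induction on n: the point mass on R^0; on
   R^n.+1 the image, under (a, x) |-> a :: x, of the product of the Lebesgue
   measures of R and R^n. *)
Section lebesgue_rVS.
Context {R : realType} (n : nat).
Variable mu : {sigma_finite_measure set 'rV[R]_n -> \bar R}.

Definition lebesgue_rVS : set 'rV[R]_n.+1 -> \bar R :=
  pushforward (product_measure1 (@lebesgue_measure R) mu) (@cons_rV R n).

Let m := measure_function_pushforward__canonical__measure_function_Measure
  (product_measure1 (@lebesgue_measure R) mu) (@measurable_cons_rV R n).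

Let lebesgue_rVS0 : lebesgue_rVS set0 = 0%E.
Proof. exact: (measure0 m). Qed.

Let lebesgue_rVS_ge0 A : (0 <= lebesgue_rVS A)%E.
Proof. exact: (measure_ge0 m). Qed.

Let lebesgue_rVS_sigma_additive : semi_sigma_additive lebesgue_rVS.
Proof. exact: (@measure_semi_sigma_additive _ _ _ m). Qed.

HB.instance Definition _ := isMeasure.Build _ _ _ lebesgue_rVS
  lebesgue_rVS0 lebesgue_rVS_ge0 lebesgue_rVS_sigma_additive.

Let lebesgue_rVS_sigma_finite : sigma_finite setT lebesgue_rVS.
Proof.
have /sigma_finiteP[F [FT ndF Foo]] := sigma_finiteT (@lebesgue_measure R).
have /sigma_finiteP[G [GT ndG Goo]] := sigma_finiteT mu.
exists (fun k => @uncons_rV R n @^-1` (F k `*` G k)).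
  rewrite -preimage_bigcup -[LHS](preimage_setT (@uncons_rV R n)).
  congr (_ @^-1` _); rewrite -setXTT FT GT predeqE => -[x y]; split.
    move=> [/= [i _ Fix] [j _ Gjy]]; exists (maxn i j) => //; split.
    - by move: x Fix; exact/subsetPset/ndF/leq_maxl.
    - by move: y Gjy; exact/subsetPset/ndG/leq_maxr.
  by move=> [i _ []/= ? ?]; split; exists i.
move=> k; have [mF Fk] := Foo k; have [mG Gk] := Goo k; split.
  rewrite -[X in measurable X]setTI; apply: measurable_uncons_rV => //.
  exact: measurableX.
rewrite /lebesgue_rVS /pushforward -comp_preimage.
rewrite (_ : _ \o _ = id) ?preimage_id; last exact/funext/cons_rVK.
by rewrite product_measure1E// lte_mul_pinfty// ge0_fin_numE.
Qed.

HB.instance Definition _ := Measure_isSigmaFinite.Build _ _ _ lebesgue_rVS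
  lebesgue_rVS_sigma_finite.

End lebesgue_rVS.

Section lebesgue_rV0.
Context {R : realType}.

Let dirac_sigma_finite :
  sigma_finite [set: 'rV[R]_0] (@dirac _ 'rV[R]_0 0 R).
Proof.
exists (fun=> setT); first by rewrite bigcup_const.
by move=> _; split => //; rewrite diracT ltry.
Qed.

Definition lebesgue_rV0 : set 'rV[R]_0 -> \bar R := @dirac _ 'rV[R]_0 0 R.

HB.instance Definition _ := Measure.on lebesgue_rV0.
HB.instance Definition _ := Measure_isSigmaFinite.Build _ _ _ lebesgue_rV0
  dirac_sigma_finite.

End lebesgue_rV0.

Fixpoint lebesgue_rV (R : realType) (n : nat) :
    {sigma_finite_measure set 'rV[R]_n -> \bar R} :=
  if n is k.+1 then lebesgue_rVS (lebesgue_rV R k) else lebesgue_rV0.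

Lemma lebesgue_rV_box (R : realType) n (A : 'I_n -> set R) :
  (forall i, measurable (A i)) ->
  lebesgue_rV R n [set x | forall i, A i (x ord0 i)] =
  (\prod_(i < n) lebesgue_measure (A i))%E.
Proof.
elim: n A => [|n IHn] A mA /=.
  by rewrite big_ord0 [LHS]diracE mem_set// => -[].
have mB : measurable
    [set x : 'rV[R]_n | forall i, A (lift ord0 i) (x ord0 i)].
  rewrite (_ : [set _ | _] = \bigcap_(i in setT)
     [set x : 'rV[R]_n | A (lift ord0 i) (x ord0 i)]).
    apply: fin_bigcap_measurable => // i _.
    rewrite -[X in measurable X]setTI.
    exact: (@measurable_coord_rV R n i measurableT _ (mA (lift ord0 i))).
  by apply/seteqP; split => [x Ax i _|x Ax i]; [exact: Ax|exact: (Ax i I)].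
rewrite big_ord_recl /lebesgue_rVS /pushforward.
rewrite -IHn; last by move=> i; exact: mA.
rewrite -product_measure1E//; last exact: mA.
congr (product_measure1 _ _ _); apply/seteqP; split => -[a x] /=.
  move=> Ax; split; first by have := Ax ord0; rewrite mxE unlift_none.
  by move=> i; have := Ax (lift ord0 i); rewrite mxE liftK.
move=> [Aa Ax] i; rewrite mxE.
by case: unliftP => [j|] ->.
Qed.

Section function_spaces.
Context {R : realType} {n : nat}.
Implicit Types (f : 'rV[R]_n -> R) (x : 'rV[R]_n).

(* k times continuously differentiable on R^n, with no bound at infinity: all
   the iterated partial derivatives of order at most k exist everywhere and are
   continuous. *)
Fixpoint Ck (k : nat) f : Prop :=
  continuous f /\
  if k is k'.+1 then
    forall i : 'I_n, (forall x, derivable f x (delta_mx ord0 i)) /\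
      Ck k' (fun x => 'D_(delta_mx ord0 i) f x)
  else True.

Definition gradient f x : 'rV[R]_n := \row_i 'D_(delta_mx ord0 i) f x.

Definition L1loc f : Prop :=
  measurable_fun [set: 'rV[R]_n] f /\
  forall K : set 'rV[R]_n, compact K ->
    (\int[lebesgue_rV R n]_(x in K) `|f x|%:E < +oo)%E.

Definition Lsp (s p : R) f : Prop :=
  L1loc f /\
  (\int[lebesgue_rV R n]_x
     (`|f x| `^ (p - 1) / (1 + enorm x) `^ (n%:R + s * p))%:E < +oo)%E.

End function_spaces.

Section fractional_p_laplacian.
Context {R : realType} {n : nat}.
Implicit Types (s p C : R) (u : 'rV[R]_n -> R) (x y : 'rV[R]_n).

Definition plap_integrand s p u x y : R :=
  `|u x - u y| `^ (p - 2) * (u x - u y) / enorm (x - y) `^ (n%:R + s * p).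

Definition plap_trunc s p u x (e : R) : R :=
  \int[lebesgue_rV R n]_(y in ~` eball x e) plap_integrand s p u x y.

(* Integrals and limits are total in the library; this says that the integrals
   and the limit in the definition of the fractional p-Laplacian at x exist,
   the latter being finite. *)
Definition frac_p_laplacian_defined s p u x : Prop :=
  (forall e : R, 0 < e ->
    (lebesgue_rV R n).-integrable (~` eball x e)
      (fun y => (plap_integrand s p u x y)%:E)) /\
  cvg (plap_trunc s p u x e @[e --> 0^'+]).

Definition frac_p_laplacian C s p u x : R :=
  C * lim (plap_trunc s p u x e @[e --> 0^'+]).

End fractional_p_laplacian.

(* Main.v *)
Require Import Defs.
From mathcomp Require Import ring lra measurable_realfun lebesgue_integral_under.

(** Write G(t) = |t|^(p-2) t, r = p - 2 and 2 al = n + s p, so that the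
    operator integrates G(u(x) - u(y)) against the kernel |x - y|^(-2 al). The
    kernel is the sum of a far kernel, which is C^1 on the whole space, agrees
    with |z|^(-2 al) outside the unit ball and controls its own partial
    derivatives, and of a near kernel, which is even, supported in the unit
    ball and bounded by a multiple of |z|^(-2 al).

    The far part x |-> \int G(u(x) - u(y)) far(x - y) dy is differentiated
    under the integral sign. The variable y being kept fixed, the derivative
    falls on u(x) and on the far kernel but never on u(y); for x bounded, the
    integrand and its derivatives are therefore at most a multiple of
    (1 + |u(y)|^(p-1)) (1 + |y|^2)^(-al), which is integrable because u is in
    L_sp ([far_integrand_dominated], [Ck1_far_integral]).

    In the near part the contributions of y = x + z and y = x - z are added.
    With a = u(x) - u(x+z), b = u(x) - u(x-z) and a_i, b_i their partial
    derivatives in x, the integrand becomes (G(a) + G(b)) near(z), and its i-th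
    partial derivative is (p - 1) near(z) times
    |a|^r a_i + |b|^r b_i = |a|^r (a_i + b_i) + (|b|^r - |a|^r) b_i.
    For x bounded and |z| < 1, a, b, a_i, b_i are O(|z|), while the
    second differences a + b and a_i + b_i are O(|z|^2): for a_i + b_i this uses
    the third derivatives of u. If r >= 1, all terms are O(|z|^p). If r < 1,
    t |-> t^r is only Hoelder continuous, so that |b|^r - |a|^r is
    O(|a + b|^r) = O(|z|^(2r)) and the last term is O(|z|^(2p-3)). With
    q = min(p, 2p-3) everything is dominated by |z|^(q - 2 al) on the unit ball,
    which is integrable exactly when q > s p; the hypothesis p > 3/(2-s) says
    that 2p - 3 > s p ([second_difference_near], [near_integrand_dominated],
    [Ck1_near_integral]).

    Finally the truncated integral over |x - y| >= e is half the truncated near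
    part, by invariance of Lebesgue measure under z |-> x + z and z |-> x - z,
    plus the truncated far part. Both integrands being integrable, the limit as
    e tends to 0 is given by dominated convergence ([plap_trunc_cvg]), and the
    fractional p-Laplacian is a linear combination of two C^1 functions. *)

Set Implicit Arguments.
Unset Strict Implicit.
Unset Printing Implicit Defensive.

Local Open Scope classical_set_scope.
Local Open Scope ring_scope.

(** * Powers of the modulus and their differences *)

Section signed_power.
Context {R : realType}.
Implicit Types r t a b M : R.

Definition sgnpow r t : R := `|t| `^ r * t.

Lemma is_derive_normpow r t : t != 0 ->
  is_derive t 1 (fun x => `|x| `^ r) (r * `|t| `^ (r - 1) * Num.sg t).
Proof.
move=> t0; have [tn|tp|tp] := ltgtP t 0; last by rewrite tp eqxx in t0.
- have H : is_derive t 1 (fun x : R => (- x) `^ r) (r * (- t) `^ (r - 1) * -1).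
    have := @is_derive1_comp R (fun x : R => x `^ r) -%R t (r * (- t) `^ (r - 1)) (-1) _ _.
    rewrite mulrN1. apply. apply: is_derive1_powR; lra.
  rewrite ltr0_norm// ltr0_sg//.
  apply: near_eq_is_derive H.
  near=> x; rewrite ltr0_norm//; near: x; exact: lt_nbhsl.
- have H : is_derive t 1 (fun x : R => x `^ r) (r * t `^ (r - 1)).
    exact: is_derive1_powR.
  rewrite gtr0_norm// gtr0_sg// mulr1.
  apply: near_eq_is_derive H.
  near=> x; rewrite gtr0_norm//; near: x; exact: (cvgr_gt t).
Unshelve. all: end_near. Qed.

Lemma continuous_normpow r : 0 < r -> continuous (fun t : R => `|t| `^ r).
Proof.
move=> r0 t; have [->|t0] := eqVneq t 0; last first.
  apply/differentiable_continuous/derivable1_diffP.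
  by have [] := is_derive_normpow r t0.
rewrite /continuous_at normr0 powR0 ?gt_eqF//.
apply/cvgrPdist_lt => e e0; near=> x.
rewrite sub0r normrN ger0_norm ?powR_ge0//.
have -> : e = (e `^ r^-1) `^ r by rewrite -powRrM mulVf ?gt_eqF// powRr1// ltW.
apply: gt0_ltr_powR; rewrite ?nnegrE ?powR_ge0//.
near: x; apply: (@cvgr0_norm_lt _ R^o _ _ _ id) => //; exact: powR_gt0.
Unshelve. all: end_near. Qed.

Lemma continuous_sgnpow r : 0 < r -> continuous (sgnpow r).
Proof. by move=> r0 t; apply: cvgM => //; exact: continuous_normpow. Qed.

(** At 0 the difference quotient is |h|^r, which tends to 0. *)
Lemma is_derive_sgnpow r t : 0 < r ->
  is_derive t 1 (sgnpow r) ((r + 1) * `|t| `^ r).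
Proof.
move=> r0; have [->|t0] := eqVneq t 0.
  rewrite normr0 powR0 ?gt_eqF// mulr0.
  have H : h^-1 *: ((sgnpow r \o shift 0) (h *: 1) - sgnpow r 0) @[h --> 0^'] --> (0:R).
    have := @continuous_normpow r r0 0; rewrite /continuous_at normr0 powR0 ?gt_eqF// => H.
    apply: cvg_trans (cvg_within_filter _ H); apply: near_eq_cvg; near=> h.
    have h0 : h != 0 by near: h; exact: nbhs_dnbhs_neq.
    rewrite /sgnpow/= addr0 mulr0 subr0 /GRing.scale/= mulr1 mulrC.
    by rewrite -mulrA divff// mulr1.
  by apply: DeriveDef; [apply/cvg_ex; exists 0|apply/cvg_lim].
have := is_derive_normpow r t0 => H.
apply: (@is_derive_eq _ _ _ (sgnpow r) t 1 _ _ (@is_deriveM _ _ (fun x => `|x| `^ r) id t 1 _ _ H _)).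
rewrite /GRing.scale/= mulr1.
have -> : t * (r * `|t| `^ (r - 1) * Num.sg t) = r * (`|t| * `|t| `^ (r - 1)).
  by rewrite {2}normrEsg; ring.
rewrite mulr_powRB1//; ring.
Unshelve. all: end_near. Qed.

End signed_power.

Section power_inequalities.
Context {R : realType}.
Implicit Types r t a b x y M K : R.

(** The mean value theorem on the segment between a and b. *)
Lemma lipschitz_of_bounded_derive (f df : R -> R) K M a b :
  (forall x, is_derive x 1 f (df x)) ->
  (forall x, `|x| <= M -> `|df x| <= K) ->
  `|a| <= M -> `|b| <= M -> `|f a - f b| <= K * `|a - b|.
Proof.
move=> fdf dfK; wlog ab : a b / b <= a => [H aM bM|].
  have [/H|/ltW/H h] := leP b a; first exact.
  by rewrite distrC (distrC a); exact: h.
move=> /ler_normlP[_ aM] /ler_normlP[bM _].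
have cf : {within `[b, a], continuous f}.
  apply/continuous_subspaceT => x.
  apply/differentiable_continuous/derivable1_diffP.
  by have [] := fdf x.
have [c cba ->] := MVT_segment ab (fun x _ => fdf x) cf.
rewrite normrM ler_wpM2r// dfK//.
by move: cba; rewrite in_itv/= ler_norml => /andP[bc ca]; apply/andP; split; lra.
Qed.

Lemma sgnpow_lipschitz r M a b : 0 < r -> `|a| <= M -> `|b| <= M ->
  `|sgnpow r a - sgnpow r b| <= (r + 1) * M `^ r * `|a - b|.
Proof.
move=> r0; apply: (lipschitz_of_bounded_derive (df := fun x => (r + 1) * `|x| `^ r)).
  by move=> x; exact: is_derive_sgnpow.
move=> x xM; rewrite normrM (ger0_norm (powR_ge0 _ _)) ger0_norm; last lra.
rewrite ler_wpM2l//; first lra.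
by rewrite ge0_ler_powR ?nnegrE ?(ltW r0)//; exact: le_trans xM.
Qed.

(** For 0 <= z <= x + y the ratio z / (x + y) is at most 1, hence at most its
    own r-th power; the two ratios, for z = x and z = y, add up to 1. *)
Lemma powR_subadditive r x y : 0 < r <= 1 -> 0 <= x -> 0 <= y ->
  (x + y) `^ r <= x `^ r + y `^ r.
Proof.
move=> /andP[r0 r1] x0 y0; have [s0|] := ltP 0 (x + y); last first.
  move=> s0; have -> : x = 0 by lra.
  have -> : y = 0 by lra.
  by rewrite addr0 powR0 ?gt_eqF// addr0.
have H z : 0 <= z -> z <= x + y -> z / (x + y) * (x + y) `^ r <= z `^ r.
  rewrite le_eqVlt => /predU1P[<-|z0] zs; first by rewrite !mul0r powR_ge0.
  have -> : z `^ r = (z / (x + y)) `^ r * (x + y) `^ r.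
    by rewrite -powRM ?divfK ?gt_eqF// ?ltW// divr_gt0.
  rewrite ler_wpM2r ?powR_ge0//; apply: ger1_powR => //.
  by rewrite divr_gt0//= ler_pdivrMr// mul1r.
apply: le_trans (lerD (H _ x0 _) (H _ y0 _)); [|lra..].
by rewrite -mulrDl -mulrDl divff ?gt_eqF// mul1r.
Qed.

Lemma normpow_sub_le1 r a b : 0 < r <= 1 ->
  `|(`|a| `^ r) - (`|b| `^ r)| <= `|a - b| `^ r.
Proof.
move=> r01; wlog ba : a b / `|b| <= `|a| => [H|].
  have [/H//|/ltW/H h] := leP `|b| `|a|.
  by rewrite distrC (distrC a).
have r0 : 0 <= r by case/andP: r01 => /ltW.
rewrite ger0_norm; last by rewrite subr_ge0 ge0_ler_powR ?nnegrE.
rewrite lerBlDl; apply: le_trans (powR_subadditive r01 _ _) => //.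
rewrite ge0_ler_powR ?nnegrE ?addr_ge0//.
by rewrite -[in leLHS](subrK b a) addrC ler_normD.
Qed.

(** The mean value theorem is applied between |b| and |a|, on the positive side,
    where the power is differentiable. *)
Lemma normpow_sub_ge1 r M a b : 1 <= r -> `|a| <= M -> `|b| <= M ->
  `|(`|a| `^ r) - (`|b| `^ r)| <= r * M `^ (r - 1) * `|a - b|.
Proof.
move=> r1; wlog ba : a b / `|b| <= `|a| => [H aM bM|aM bM].
  have [/H|/ltW/H h] := leP `|b| `|a|; first exact.
  by rewrite distrC (distrC a); exact: h.
have cf : {within `[`|b|, `|a|], continuous (fun x : R => `|x| `^ r)}.
  by apply/continuous_subspaceT; apply: continuous_normpow; lra.
have df x : x \in `]`|b|, `|a|[ ->
    is_derive x 1 (fun x : R => `|x| `^ r) (r * `|x| `^ (r - 1) * Num.sg x).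
  rewrite in_itv/= => /andP[bx _]; apply: is_derive_normpow.
  by rewrite gt_eqF// (le_lt_trans _ bx).
have [c] := MVT_segment ba df cf; rewrite in_itv/= => /andP[bc ca].
rewrite !normr_id => ->; rewrite 3!normrM.
have c0 : 0 <= c by exact: le_trans bc.
have M0 : 0 <= M by exact: le_trans aM.
have abd := ler_dist_dist a b.
rewrite (ger0_norm (powR_ge0 _ _)) [`|r|]ger0_norm; last lra.
apply: ler_pM => //; rewrite ?mulr_ge0 ?powR_ge0//; first lra.
rewrite -[leRHS]mulr1; apply: ler_pM; rewrite ?mulr_ge0 ?powR_ge0//; first lra.
- rewrite ler_wpM2l//; first lra.
  rewrite ge0_ler_powR ?nnegrE//; first lra.
  by rewrite ger0_norm//; exact: le_trans aM.
- by rewrite normr_sg; case: (c != 0); rewrite ?lexx ?ler01.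
Qed.

End power_inequalities.

Lemma powR_exprn (R : realType) (a b : R) (k : nat) : 0 <= a -> (a ^+ k) `^ b = (a `^ b) ^+ k.
Proof.
by move=> a0; rewrite -powR_mulrn// -powRrM mulrC powRrM powR_mulrn ?powR_ge0.
Qed.

Lemma ltr_powR2r (R : realType) (a b : R) : a < b -> 2 `^ a < 2 `^ b.
Proof.
by move=> ab; rewrite /powR pnatr_eq0/= ltr_expR ltr_pM2r// ln_gt0// ltr1n.
Qed.

Lemma powRN_le (R : realType) (a b c : R) : 0 <= c -> 0 < a -> a <= b -> b `^ (- c) <= a `^ (- c).
Proof.
move=> c0 a0 ab; have b0 : 0 < b by exact: lt_le_trans ab.
by rewrite !powRN lef_pV2 ?posrE ?powR_gt0// ge0_ler_powR ?nnegrE// ltW.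
Qed.

Lemma powR_invN (R : realType) (a b : R) : 0 <= a -> a^-1 `^ (- b) = a `^ b.
Proof. by move=> a0; rewrite -powR_inv1// -powRrM mulN1r opprK. Qed.

(** Moves a positive constant in and out of a negative power, to compare two
    kernels up to a constant. *)
Lemma powR_cancel (R : realType) (a x b : R) : 0 < a -> 0 <= x ->
  x `^ (- b) = a `^ b * (a * x) `^ (- b).
Proof.
move=> a0 x0; rewrite powRM ?(ltW a0)// mulrA (powRN a) divff ?mul1r//.
by rewrite gt_eqF// powR_gt0.
Qed.

Section growth.
Context {R : realType}.
Implicit Types r a b A : R.

Lemma norm_sgnpow r a : 0 <= r -> `|sgnpow r a| = `|a| `^ (r + 1).
Proof.
move=> r0; rewrite /sgnpow normrM (ger0_norm (powR_ge0 _ _)).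
rewrite powRD ?powRr1//; apply/implyP; lra.
Qed.

(** The constant depends on a only through its bound A, so that the estimate is
    uniform when a = u(x) with x bounded. *)
Lemma normpow_sub_le r a b A : 0 <= r -> `|a| <= A ->
  `|a - b| `^ r <= 2 `^ r * (A `^ r + 1) * (1 + `|b| `^ r).
Proof.
move=> r0 aA; have A0 : 0 <= A by exact: le_trans aA.
have h1 : 0 <= A `^ r := powR_ge0 _ _.
have h2 : 0 <= `|b| `^ r := powR_ge0 _ _.
have h3 : 0 <= 2 `^ r :> R := powR_ge0 _ _.
have abm : `|a - b| <= 2 * Num.max A `|b|.
  apply: le_trans (ler_normB _ _) _; rewrite mulr_natl mulr2n lerD// le_max.
    by rewrite aA.
  by rewrite lexx orbT.
apply: le_trans (_ : (2 * Num.max A `|b|) `^ r <= _).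
  by rewrite ge0_ler_powR ?nnegrE// (le_trans _ abm).
rewrite powRM//; last by rewrite le_max A0.
rewrite -mulrA ler_wpM2l//.
by have [_|_] := leP A `|b|; nra.
Qed.

Lemma normpow_le_succ r a : 0 <= r -> `|a| `^ r <= 1 + `|a| `^ (r + 1).
Proof.
move=> r0; have [a1|a1] := leP 1 `|a|.
  by rewrite ler_wpDl// ler_powR// lerDl.
have h2 : 0 <= `|a| `^ (r + 1) := powR_ge0 _ _.
apply: (@le_trans _ _ (1 `^ r)); last by rewrite powR1; lra.
by rewrite ge0_ler_powR ?nnegrE// ltW.
Qed.

End growth.

Section near_exponent.
Context {R : realType}.
Implicit Types r t a b L S : R.

(** In terms of p = r + 2 this is min(2p - 3, p). *)
Definition near_exponent r := Num.min (2 * r + 1) (r + 2).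

Lemma powR_near_exponent r t a : 0 < t <= 1 -> near_exponent r <= a ->
  t `^ a <= t `^ near_exponent r.
Proof. by move=> t01 qa; exact: ger_powR. Qed.

Lemma near_exponent_le2 r : near_exponent r <= r + 2.
Proof. by rewrite ge_min lexx orbT. Qed.

Lemma powR_mul_sqr r t : 0 <= t -> 0 <= r -> t `^ r * t ^+ 2 = t `^ (r + 2).
Proof.
move=> t0 r0; rewrite -(powR_mulrn 2 t0) -powRD//.
by rewrite paddr_eq0// pnatr_eq0 andbF.
Qed.

(** The only place where the size of r relative to 1 matters. For r <= 1 the
    power is r-Hoelder and the loss is t^(2r) t; for r > 1 it is Lipschitz with
    constant r (L t)^(r-1) on [-L t, L t]. *)
Lemma normpow_diff_near r L S : 0 < r -> 0 <= L -> 0 <= S ->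
  exists2 D, 0 <= D & forall t a b, 0 < t <= 1 ->
    `|a| <= L * t -> `|b| <= L * t -> `|a + b| <= S * t ^+ 2 ->
    `|(`|b| `^ r) - (`|a| `^ r)| * (L * t) <= D * t `^ near_exponent r.
Proof.
move=> r0 L0 S0.
have abE a b : `|(`|b| `^ r) - (`|a| `^ r)| = `|(`|b| `^ r) - (`|- a| `^ r)| by rewrite normrN.
have [r1|r1] := leP r 1.
  exists (S `^ r * L); first by rewrite mulr_ge0 ?powR_ge0.
  move=> t a b /[dup] t01 /andP[t0 t1] aL bL abS.
  have tp : 0 <= t := ltW t0.
  apply: le_trans (_ : (S * t ^+ 2) `^ r * (L * t) <= _).
    rewrite ler_wpM2r ?mulr_ge0// abE.
    apply: le_trans (normpow_sub_le1 _ _ (_ : 0 < r <= 1)) _; first by rewrite r0.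
    by rewrite opprK addrC ge0_ler_powR ?nnegrE ?(ltW r0)// (le_trans _ abS).
  have -> : (S * t ^+ 2) `^ r * (L * t) = S `^ r * L * t `^ (2 * r + 1).
    rewrite powRM ?sqr_ge0// -(powR_mulrn 2 tp) -powRrM.
    rewrite [in RHS]powRD ?powRr1//; first by ring.
    by rewrite (gt_eqF t0) implybT.
  rewrite ler_wpM2l ?mulr_ge0 ?powR_ge0//; apply: powR_near_exponent => //.
  by rewrite ge_min lexx.
have r1' : 0 <= r - 1 by rewrite subr_ge0 ltW.
exists (r * L `^ (r - 1) * S * L); first by rewrite !mulr_ge0 ?powR_ge0// ltW.
move=> t a b /[dup] t01 /andP[t0 t1] aL bL abS.
have tp : 0 <= t := ltW t0.
apply: le_trans (_ : r * (L * t) `^ (r - 1) * (S * t ^+ 2) * (L * t) <= _).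
  rewrite ler_wpM2r ?mulr_ge0// abE.
  apply: le_trans (normpow_sub_ge1 (ltW r1) bL (_ : `|- a| <= _)) _.
    by rewrite normrN.
  by rewrite opprK [b + a]addrC ler_wpM2l// mulr_ge0 ?powR_ge0// ltW.
have -> : r * (L * t) `^ (r - 1) * (S * t ^+ 2) * (L * t) =
    r * L `^ (r - 1) * S * L * t `^ (r + 2).
  rewrite powRM// -powR_mul_sqr ?(ltW r0)// -(mulr_powRB1 tp r0); ring.
rewrite ler_wpM2l ?mulr_ge0 ?powR_ge0 ?(ltW r0)//.
by apply: powR_near_exponent => //; exact: near_exponent_le2.
Qed.

(** The sums are small by cancellation: - b is within S t^2 of a, and - b' within
    S t^2 of a'. In the application a and b are the differences of u at x
    towards x + z and x - z, a' and b' those of a partial derivative of u, and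
    t = |z|. *)
Lemma second_difference_near r L S : 0 < r -> 0 <= L -> 0 <= S ->
  exists2 C, 0 <= C & forall t a b a' b', 0 < t <= 1 ->
    `|a| <= L * t -> `|b| <= L * t -> `|a + b| <= S * t ^+ 2 ->
    `|b'| <= L * t -> `|a' + b'| <= S * t ^+ 2 ->
    `|sgnpow r a + sgnpow r b| <= C * t `^ near_exponent r /\
    `|(`|a| `^ r) * a' + (`|b| `^ r) * b'| <= C * t `^ near_exponent r.
Proof.
move=> r0 L0 S0; have [D D0 DP] := normpow_diff_near r0 L0 S0.
have E0 : 0 <= L `^ r * S by rewrite mulr_ge0 ?powR_ge0.
have r10 : 1 <= r + 1 by rewrite lerDr ltW.
exists ((r + 1) * (L `^ r * S) + D).
  by apply: addr_ge0 => //; apply: mulr_ge0 => //; exact: le_trans r10.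
move=> t a b a' b' /[dup] t01 /andP[t0 t1] aL bL abS b'L abS'.
have tp : 0 <= t := ltW t0.
have q0 : 0 <= t `^ near_exponent r := powR_ge0 _ _.
have H : (L * t) `^ r * (S * t ^+ 2) <= L `^ r * S * t `^ near_exponent r.
  have -> : (L * t) `^ r * (S * t ^+ 2) = L `^ r * S * t `^ (r + 2).
    by rewrite powRM// -powR_mul_sqr ?(ltW r0)//; ring.
  rewrite ler_wpM2l//; apply: powR_near_exponent => //; exact: near_exponent_le2.
rewrite mulrDl; split.
  have -> : sgnpow r a + sgnpow r b = sgnpow r a - sgnpow r (- b).
    by rewrite /sgnpow normrN mulrN opprK.
  apply: le_trans (sgnpow_lipschitz r0 aL (_ : `|- b| <= _)) _; first by rewrite normrN.
  rewrite opprK; apply: le_trans (_ : (r + 1) * (L `^ r * S * t `^ near_exponent r) <= _).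
    rewrite -mulrA ler_wpM2l ?(le_trans ler01)//.
    by apply: le_trans H; rewrite ler_wpM2l ?powR_ge0.
  by rewrite mulrA lerDl mulr_ge0.
have -> : `|a| `^ r * a' + `|b| `^ r * b' =
    `|a| `^ r * (a' + b') + (`|b| `^ r - `|a| `^ r) * b' by ring.
apply: le_trans (ler_normD _ _) _; apply: lerD.
  apply: le_trans (_ : (L * t) `^ r * (S * t ^+ 2) <= _).
    rewrite normrM (ger0_norm (powR_ge0 _ _)); apply: ler_pM => //.
    by rewrite ge0_ler_powR ?nnegrE ?mulr_ge0 ?(ltW r0).
  apply: le_trans H _; rewrite -[(r + 1) * _ * _]mulrA.
  by rewrite ler_peMl// mulr_ge0.
rewrite normrM; apply: le_trans (DP t a b t01 aL bL abS).
by rewrite ler_wpM2l.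
Qed.

End near_exponent.

(** * Continuity and directional derivatives *)

Section pointwise_continuity.
Context {R : realType} {T : topologicalType}.
Implicit Types f g : T -> R.

Lemma continuous_mul f g :
  continuous f -> continuous g -> continuous (fun x => f x * g x).
Proof. by move=> cf cg x; apply: (@continuousM R T f g x); [exact: cf|exact: cg]. Qed.

Lemma continuous_add f g :
  continuous f -> continuous g -> continuous (fun x => f x + g x).
Proof. by move=> cf cg x; apply: (@continuousD R R^o T f g x); [exact: cf|exact: cg]. Qed.

Lemma continuous_sub f g :
  continuous f -> continuous g -> continuous (fun x => f x - g x).
Proof. by move=> cf cg x; apply: (@continuousB R R^o T f g x); [exact: cf|exact: cg]. Qed.

Lemma continuous_compose (U V : topologicalType) (f : T -> U) (g : U -> V) :
  continuous f -> continuous g -> continuous (fun x => g (f x)).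
Proof. by move=> cf cg x; apply: continuous_comp; [exact: cf|exact: cg]. Qed.

Lemma continuous_const (c : R) : continuous (fun _ : T => c).
Proof. exact: cst_continuous. Qed.

End pointwise_continuity.

Section translates.
Context {R : realType} {V : normedModType R}.
Implicit Types (f : V -> R) (x y z : V).

Lemma continuous_comp_addr f z : continuous f -> continuous (fun x => f (x + z)).
Proof.
move=> cf; apply: continuous_compose cf => x.
by apply: (@continuousD R V _ id (cst z) x); [exact: cvg_id|exact: cst_continuous].
Qed.

Lemma continuous_comp_addl f x : continuous f -> continuous (fun z => f (x + z)).
Proof.
move=> cf; apply: continuous_compose cf => z.
by apply: (@continuousD R V _ (cst x) id z); [exact: cst_continuous|exact: cvg_id].
Qed.

Lemma continuous_comp_subl f x : continuous f -> continuous (fun z => f (x - z)).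
Proof.
move=> cf; apply: continuous_compose cf => z.
by apply: (@continuousB R V _ (cst x) id z); [exact: cst_continuous|exact: cvg_id].
Qed.

End translates.

Section powers_of_differences.
Context {R : realType} {T : topologicalType}.
Variables (r : R) (f g : T -> R).
Hypothesis r0 : 0 < r.

Lemma continuous_sgnpow_sub : continuous f -> continuous g ->
  continuous (fun x => sgnpow r (f x - g x)).
Proof.
move=> cf cg; apply: continuous_compose (continuous_sgnpow r0).
exact: continuous_sub.
Qed.

Lemma continuous_normpow_sub : continuous f -> continuous g ->
  continuous (fun x => `|f x - g x| `^ r).
Proof.
move=> cf cg; apply: continuous_compose (continuous_normpow r0).
exact: continuous_sub.
Qed.

End powers_of_differences.

Lemma continuous_powR_pos (R : realType) (T : topologicalType) (f : T -> R) (b : R) :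
  continuous f -> (forall x, 0 < f x) -> continuous (fun x => f x `^ b).
Proof.
move=> cf f0 x.
have cp : {for f x, continuous (fun t : R => t `^ b)}.
  apply/differentiable_continuous/derivable1_diffP.
  by have [] := is_derive1_powR b (f0 x).
exact: (continuous_comp (cf x) cp).
Qed.

(** Reduces a directional derivative to one of a function of a real variable,
    for which the mean value theorem and the chain rule are available. *)
Lemma is_derive_lineP (R : realType) (V : normedModType R) (f : V -> R)
    (x v : V) (t df : R) :
  is_derive (t *: v + x) v f df <-> is_derive t 1 (fun t : R => f (t *: v + x)) df.
Proof.
have E (h : R) : (h *: 1 + t) *: v + x = h *: v + (t *: v + x).
  by rewrite scalerDl addrA [_%:A]mulr1.
have dE : derivable f (t *: v + x) v = derivable (fun t : R => f (t *: v + x)) t 1.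
  rewrite /derivable; set g1 := fun h => h^-1 *: _; set g2 := fun h => h^-1 *: _.
  suff -> : g1 = g2 by [].
  by rewrite /g1 /g2; apply/funext => h /=; rewrite E.
have DE : 'D_v f (t *: v + x) = 'D_1 (fun t : R => f (t *: v + x)) t.
  rewrite /derive; set g1 := fun h => h^-1 *: _; set g2 := fun h => h^-1 *: _.
  suff -> : g1 = g2 by [].
  by rewrite /g1 /g2; apply/funext => h /=; rewrite E.
split=> -[H1 H2]; apply: DeriveDef.
- by rewrite -dE.
- by rewrite -DE.
- by rewrite dE.
- by rewrite DE.
Qed.

Lemma is_derive_translate (R : realType) (V : normedModType R) (f : V -> R)
    (x y v : V) (df : R) :
  is_derive (x - y) v f df -> is_derive x v (fun x => f (x - y)) df.
Proof.
have E : x - y = 0 *: v + (x - y) by rewrite scale0r add0r.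
have E' : x = 0 *: v + x by rewrite scale0r add0r.
rewrite E => /(is_derive_lineP f (x - y)) H; rewrite E'.
apply/(is_derive_lineP (fun x => f (x - y)) x).
by under eq_fun do rewrite -addrA.
Qed.

Lemma is_derive_comp1 (R : realType) (V : normedModType R) (f : R -> R) (g : V -> R)
    (x v : V) (df dg : R) :
  is_derive (g x) 1 f df -> is_derive x v g dg ->
  is_derive x v (fun y => f (g y)) (df * dg).
Proof.
move=> Df Dg.
have E : x = 0 *: v + x by rewrite scale0r add0r.
move: Df Dg; rewrite E => Df /(is_derive_lineP g x) Dg.
apply/(is_derive_lineP (fun y => f (g y)) x).
exact: (@is_derive1_comp R f (fun t => g (t *: v + x)) 0 df dg Df Dg).
Qed.

(** * Local estimates for functions with continuous partial derivatives *)

Section rV_norm.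
Context {R : realType} {n : nat}.
Implicit Types x z : 'rV[R]_n.

Lemma coord_le_norm x i : `|x ord0 i| <= `|x|.
Proof.
by rewrite [leRHS]/Num.norm/= mx_normrE; apply/bigmax_geP; right; exists (ord0, i).
Qed.

Lemma rV_norm_le x (K : R) : 0 <= K -> (forall i, `|x ord0 i| <= K) -> `|x| <= K.
Proof.
move=> K0 xK; rewrite [leLHS]/Num.norm/= mx_normrE; apply/bigmax_leP; split => //.
by move=> -[i j] _ /=; rewrite ord1.
Qed.

Lemma norm_delta_mx_le1 (i : 'I_n) : `|delta_mx ord0 i : 'rV[R]_n| <= 1.
Proof.
apply: rV_norm_le => // j; rewrite mxE eqxx/=.
by case: (_ == _); rewrite ?normr1 ?normr0.
Qed.

Lemma continuous_coord (i : 'I_n) : continuous (fun x : 'rV[R]_n => x ord0 i).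
Proof. exact: coord_continuous. Qed.

End rV_norm.

Lemma MVT_from0 (R : realType) (g dg : R -> R) (h : R) :
  (forall t : R, is_derive t 1 g (dg t)) ->
  exists2 c, `|c| <= `|h| & g h - g 0 = dg c * h.
Proof.
move=> gdg.
have cg a b : {within `[a, b], continuous g}.
  apply/continuous_subspaceT => x.
  apply/differentiable_continuous/derivable1_diffP.
  by have [] := gdg x.
have [h0|/ltW h0] := leP 0 h.
  have [c] := MVT_segment h0 (fun x _ => gdg x) (cg _ _).
  rewrite in_itv/= subr0 => /andP[c0 ch] E; exists c => //.
  by rewrite !ger0_norm.
have [c] := MVT_segment h0 (fun x _ => gdg x) (cg _ _).
rewrite in_itv/= sub0r => /andP[ch c0] E; exists c.
  by rewrite !ler0_norm// lerN2.
by apply/eqP; rewrite -eqr_opp opprB E mulrN.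
Qed.

Section local_estimates.
Context {R : realType} {n : nat}.
Implicit Types (f : 'rV[R]_n -> R) (x z : 'rV[R]_n).

(** Going from x to x + z by changing one coordinate at a time only requires the
    partial derivatives of f along segments parallel to the axes; no chain rule
    for functions of several variables is involved. *)
Lemma coordwise_MVT f x z :
  (forall i y, derivable f y (delta_mx ord0 i)) ->
  exists xi : 'I_n -> 'rV[R]_n, (forall i, `|xi i| <= `|z|) /\
    f (x + z) - f x = \sum_i z ord0 i * 'D_(delta_mx ord0 i) f (x + xi i).
Proof.
move=> df.
(* The first k coordinates of z followed by zeros: the vertices of the path from 0 to z. *)
pose zk (k : nat) : 'rV[R]_n := \row_j (if (j < k)%N then z ord0 j else 0).
have zkS (i : 'I_n) : zk i.+1 = z ord0 i *: delta_mx ord0 i + zk i.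
  apply/rowP => j; rewrite !mxE eqxx/= ltnS leq_eqVlt -[_ == _ :> nat]/(j == i).
  have [->|ji] := eqVneq j i; first by rewrite ltnn mulr1 addr0.
  by rewrite mulr0 add0r.
have step (i : 'I_n) : exists c : R, `|c| <= `|z ord0 i| /\
    f (x + zk i.+1) - f (x + zk i) =
    z ord0 i * 'D_(delta_mx ord0 i) f (x + (c *: delta_mx ord0 i + zk i)).
  have [t|c cz E] := @MVT_from0 R (fun t => f (t *: delta_mx ord0 i + (x + zk i)))
      (fun t => 'D_(delta_mx ord0 i) f (t *: delta_mx ord0 i + (x + zk i))) (z ord0 i).
    by apply/(is_derive_lineP f (x + zk i)); apply: derivableP; exact: df.
  exists c; split => //.
  rewrite zkS [x + (_ + _)]addrCA [x + (c *: _ + _)]addrCA mulrC -E.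
  by rewrite scale0r add0r.
have [c cP] := choice step.
exists (fun i => c i *: delta_mx ord0 i + zk i); split.
  move=> i; apply: rV_norm_le => // j; rewrite !mxE eqxx/=.
  have [ji|ji] := eqVneq j i.
    rewrite ji ltnn mulr1 addr0; apply: le_trans (coord_le_norm z i).
    by case: (cP i).
  rewrite mulr0 add0r; case: ifP => _; rewrite ?normr0//; exact: coord_le_norm.
under eq_bigr => i _ do rewrite -(cP i).2.
rewrite -(big_mkord xpredT (fun i => f (x + zk i.+1) - f (x + zk i))).
rewrite telescope_sumr//; congr (f (x + _) - f _).
  by apply/rowP => j; rewrite mxE ltn_ord.
by rewrite -[LHS]addr0; congr (_ + _); apply/rowP => j; rewrite !mxE ltn0.
Qed.

Lemma continuous_locally_bounded f (M : R) : continuous f ->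
  exists2 C : R, 0 <= C & forall x, `|x| <= M -> `|f x| <= C.
Proof.
move=> cf; have [M0|M0] := ltP M 0.
  by exists 0 => // x xM; have := normr_ge0 x; lra.
have cB : compact [set x : 'rV[R]_n | `|x| <= M].
  apply: bounded_closed_compact.
    exists M; split; first exact: num_real.
    by move=> N MN x /= xM; exact: le_trans (ltW MN).
  rewrite (_ : [set x | _] = (fun x : 'rV[R]_n => `|x|) @^-1` [set t : R | t <= M])//.
  apply: preimage_closed => //; first by move=> x _; exact: norm_continuous.
have B0 : [set x : 'rV[R]_n | `|x| <= M] !=set0 by exists 0 => /=; rewrite normr0.
have [c _ cP] := @EVT_max_rV R n (fun x => `|f x|) _ B0 cB
  (continuous_subspaceT (fun x => cvg_norm (cf x))).
by exists `|f c| => // x xM; apply: cP; rewrite inE.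
Qed.

Lemma Ck_continuous k f : Ck k f -> continuous f.
Proof. by case: k => [|k] []. Qed.

Lemma Ck_derivable k f : Ck k.+1 f ->
  forall i x, derivable f x (delta_mx ord0 i).
Proof. by move=> [_ H] i x; have [] := H i. Qed.

Lemma Ck_derive k f i : Ck k.+1 f -> Ck k ('D_(delta_mx ord0 i) f).
Proof. by move=> [_ H]; have [] := H i. Qed.

Lemma CkW k f : Ck k.+1 f -> Ck k f.
Proof.
elim: k f => [|k IH] f [cf H]; first by split.
split=> // i; have [df Cf] := H i; split => //; exact: IH.
Qed.

Lemma partials_locally_bounded f (M : R) : Ck 1 f ->
  exists2 C : R, 0 <= C & forall i x, `|x| <= M -> `|'D_(delta_mx ord0 i) f x| <= C.
Proof.
move=> Cf.
have H i : exists C : R, 0 <= C /\ forall x, `|x| <= M -> `|'D_(delta_mx ord0 i) f x| <= C.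
  by have [C C0 CP] := continuous_locally_bounded M (Ck_continuous (Ck_derive i Cf)); exists C.
have [C CP] := choice H.
exists (\sum_i C i); first by apply: sumr_ge0 => i _; case: (CP i).
move=> i x xM; apply: le_trans (_ : C i <= _); first by case: (CP i) => _; exact.
by rewrite (bigD1 i)//= lerDl sumr_ge0// => j _; case: (CP j).
Qed.

Lemma Ck1_locally_lipschitz f (M : R) : Ck 1 f ->
  exists2 C : R, 0 <= C & forall x z, `|x| <= M -> `|z| <= M ->
    `|f (x + z) - f x| <= C * `|z|.
Proof.
move=> Cf; have [C C0 CP] := partials_locally_bounded (M + M) Cf.
exists (n%:R * C); first by rewrite mulr_ge0.
move=> x z xM zM; have [xi [xiz ->]] := coordwise_MVT x z (Ck_derivable Cf).
apply: le_trans (ler_norm_sum _ _ _) _.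
apply: le_trans (_ : \sum_(i < n) C * `|z| <= _).
  apply: ler_sum => i _; rewrite normrM mulrC ler_pM//; last exact: coord_le_norm.
  apply: CP; apply: le_trans (ler_normD _ _) _; apply: lerD => //.
  exact: le_trans (xiz i) _.
by rewrite sumr_const card_ord -mulrA mulr_natl.
Qed.

(** Expand f (x + z) - f x and f (x - z) - f x by [coordwise_MVT]: the increments
    z_i and - z_i are opposite, so that only differences of the same partial
    derivative at two points at distance at most 2 |z| remain. *)
Lemma Ck2_second_difference f (M : R) : Ck 2 f ->
  exists2 C : R, 0 <= C & forall x z, `|x| <= M -> `|z| <= M ->
    `|f (x + z) + f (x - z) - f x *+ 2| <= C * `|z| ^+ 2.
Proof.
move=> Cf.
have H i : exists C : R, 0 <= C /\ forall x z, `|x| <= M + M + M -> `|z| <= M + M + M ->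
    `|'D_(delta_mx ord0 i) f (x + z) - 'D_(delta_mx ord0 i) f x| <= C * `|z|.
  have [C C0 CP] := Ck1_locally_lipschitz (M + M + M) (Ck_derive i Cf).
  by exists C.
have [C CP] := choice H.
exists (\sum_i C i * 2).
  by apply: sumr_ge0 => i _; rewrite mulr_ge0//; case: (CP i).
move=> x z xM zM; have M0 : 0 <= M by exact: le_trans xM.
have [xi [xiz E1]] := coordwise_MVT x z (Ck_derivable Cf).
have [eta [etaz E2]] := coordwise_MVT x (- z) (Ck_derivable Cf).
have -> : f (x + z) + f (x - z) - f x *+ 2 =
    (f (x + z) - f x) + (f (x - z) - f x) by rewrite mulr2n; ring.
rewrite E1 E2 -big_split/=.
apply: le_trans (ler_norm_sum _ _ _) _.
rewrite mulr_suml; apply: ler_sum => i _.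
rewrite mxE mulNr -mulrBr normrM.
have -> : x + xi i = (x + eta i) + (xi i - eta i).
  by rewrite -addrA; congr (_ + _); rewrite addrC subrK.
have xe : `|xi i - eta i| <= 2 * `|z|.
  apply: le_trans (ler_normB _ _) _; rewrite mulr_natl mulr2n.
  by apply: lerD; rewrite // -[leRHS]normrN.
have [Ci0 CiP] := CP i.
rewrite expr2 mulrA [leRHS]mulrC ler_pM ?coord_le_norm//.
apply: le_trans (CiP _ _ _ _) _.
- apply: le_trans (ler_normD _ _) _.
  by have := etaz i; rewrite normrN; lra.
- by apply: le_trans xe _; lra.
- by rewrite -mulrA ler_wpM2l.
Qed.

End local_estimates.

Lemma Ck1_linear_combination (R : realType) n (a b : R) (f g : 'rV[R]_n -> R) :
  Ck 1 f -> Ck 1 g -> Ck 1 (fun x => a * f x + b * g x).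
Proof.
move=> Cf Cg.
have clin (h k : 'rV[R]_n -> R) : continuous h -> continuous k ->
    continuous (fun x => a * h x + b * k x).
  by move=> ch ck; apply: continuous_add; apply: continuous_mul => //; exact: continuous_const.
split; first by apply: clin; [exact: Ck_continuous Cf|exact: Ck_continuous Cg].
move=> i.
have D x : is_derive x (delta_mx ord0 i) (fun x => a * f x + b * g x)
    (a * 'D_(delta_mx ord0 i) f x + b * 'D_(delta_mx ord0 i) g x).
  have df := derivableP (@Ck_derivable _ _ _ _ Cf i x).
  have dg := derivableP (@Ck_derivable _ _ _ _ Cg i x).
  by apply: is_derive_eq; rewrite /GRing.scale/=; ring.
split; first by move=> x; have [] := D x.
split => //.
have -> : 'D_(delta_mx ord0 i) (fun x => a * f x + b * g x) =
  (fun x => a * 'D_(delta_mx ord0 i) f x + b * 'D_(delta_mx ord0 i) g x).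
  by apply/funext => x; have [_ ->] := D x.
by apply: clin; [exact: Ck_continuous (Ck_derive i Cf)|exact: Ck_continuous (Ck_derive i Cg)].
Qed.

(** * Differentiation of integrals depending on a parameter *)

(** Limits in a pseudometric space can be tested on sequences, which gives
    access to dominated convergence for parameters in R^n. *)
Lemma cvg_of_sequences (R : realType) (V : pseudoMetricType R) (f : V -> R)
    (p : V) (l : R) :
  (forall u : nat -> V, u k @[k --> \oo] --> p -> f (u k) @[k --> \oo] --> l) ->
  f x @[x --> p] --> l.
Proof.
move=> H; apply: contrapT => fl.
have [e e0 eP] : exists2 e : R, 0 < e &
    forall d : R, 0 < d -> exists x, ball p d x /\ e <= `|l - f x|.
  apply: contrapT => N; apply: fl; apply/cvgrPdist_lt => e e0.
  apply: contrapT => Ne; apply: N; exists e => // d d0.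
  apply: contrapT => Nx; apply: Ne; apply/nbhs_ballP; exists d => // x px /=.
  by rewrite ltNge; apply/negP => ex; apply: Nx; exists x.
have [u uP] := choice (fun k : nat => eP k.+1%:R^-1 (ltac:(by rewrite invr_gt0))).
have up : u k @[k --> \oo] --> p.
  apply/cvg_ballP => d d0; near=> k.
  apply: (@le_ball _ _ p k.+1%:R^-1); last by case: (uP k).
  by apply: ltW; near: k; exact: near_infty_natSinv_lt (PosNum d0).
have /cvgrPdist_lt/(_ e e0)[N _ /(_ N (leqnn N))/=] := H u up.
by rewrite ltNge; have [_ ->] := uP N.
Unshelve. all: end_near. Qed.

Section parametric_integral.
Context {R : realType} {n : nat} d {T : measurableType d}.
Variable mu : {measure set T -> \bar R}.
Implicit Types (f : 'rV[R]_n -> T -> R) (g : T -> R).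

Lemma continuous_parametric_integral f :
  (forall x, measurable_fun [set: T] (f x)) ->
  (forall y, continuous (f ^~ y)) ->
  (forall M, exists2 g, mu.-integrable [set: T] (EFin \o g) &
     forall x y, `|x| <= M -> `|f x y| <= g y) ->
  continuous (fun x => \int[mu]_y f x y).
Proof.
move=> mf cf dom x; apply: cvg_of_sequences => w wx.
have [g ig fg] := dom (`|x| + 1).
have wM : \forall k \near \oo, `|w k| <= `|x| + 1.
  have /cvgrPdist_lt/(_ 1 ltr01) H := wx.
  near=> k; have : `|x - w k| < 1 by near: k.
  move=> xw; rewrite -[w k](subrK x) addrC; apply: le_trans (ler_normD _ _) _.
  by rewrite lerD2l distrC ltW.
have [N _ NP] := wM.
rewrite -(cvg_shiftn N).
apply: fine_cvg.
have intfx z : `|z| <= `|x| + 1 -> mu.-integrable [set: T] (EFin \o f z).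
  move=> zx; apply: (le_integrable _ _ _ ig) => //.
    exact/measurable_EFinP.
  by move=> y _; rewrite lee_fin (le_trans (fg _ _ zx))// ler_norm.
rewrite /Rintegral fineK; last first.
  by apply: integrable_fin_num => //; apply: intfx; rewrite lerDl.
have ptcvg : {ae mu, forall y, [set: T] y ->
    (f (w (k + N)%N) y)%:E @[k --> \oo] --> (f x y)%:E}.
  apply/aeW => y _; apply: cvg_EFin; first exact: nearW.
  apply: (@cvg_comp _ _ _ (fun k => w (k + N)%N) (f ^~ y) _ (nbhs x)); last exact: cf.
  by rewrite (cvg_shiftn N).
have bound : {ae mu, forall y k, [set: T] y ->
    (`|(f (w (k + N)%N) y)%:E| <= (g y)%:E)%E}.
  apply/aeW => y k _; rewrite lee_fin; apply: fg; apply: NP.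
  by rewrite /= leq_addl.
have mfw k : measurable_fun [set: T] (EFin \o f (w (k + N)%N)) by exact/measurable_EFinP.
have mfx : measurable_fun [set: T] (EFin \o f x) by exact/measurable_EFinP.
by have [_ _] := dominated_convergence measurableT mfw mfx ptcvg ig bound.
Unshelve. all: end_near. Qed.

(** Differentiation under the integral sign along each line parallel to an axis,
    followed by dominated convergence for the continuity of the result. The
    dominating function may depend on the radius M of the ball of parameters. *)
Lemma Ck1_parametric_integral f (df : 'I_n -> 'rV[R]_n -> T -> R) :
  (forall x, measurable_fun [set: T] (f x)) ->
  (forall i x, measurable_fun [set: T] (df i x)) ->
  (forall i x y, is_derive x (delta_mx ord0 i) (f ^~ y) (df i x y)) ->
  (forall y, continuous (f ^~ y)) ->
  (forall i y, continuous (df i ^~ y)) ->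
  (forall M, exists2 g, mu.-integrable [set: T] (EFin \o g) &
     forall x y, `|x| <= M ->
       `|f x y| <= g y /\ forall i, `|df i x y| <= g y) ->
  Ck 1 (fun x => \int[mu]_y f x y).
Proof.
move=> mf mdf fdf cf cdf dom.
split.
  apply: continuous_parametric_integral => // M; have [g ig fg] := dom M.
  by exists g => // x y xM; have [] := fg x y xM.
move=> i.
have int_f M g x : mu.-integrable [set: T] (EFin \o g) ->
    (forall x y, `|x| <= M -> `|f x y| <= g y /\ forall i, `|df i x y| <= g y) ->
    `|x| <= M -> mu.-integrable [set: T] (EFin \o f x).
  move=> ig fg xM; apply: (le_integrable _ _ _ ig) => //.
    exact/measurable_EFinP.
  by move=> y _; rewrite lee_fin (le_trans (fg _ _ xM).1)// ler_norm.
have H x : is_derive x (delta_mx ord0 i) (fun x => \int[mu]_y f x y) (\int[mu]_y df i x y).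
  have [g ig fg] := dom (`|x| + 1).
  pose h (t : R) y := f (t *: delta_mx ord0 i + x) y.
  have hd (t : R) y : is_derive t 1 (h ^~ y) (df i (t *: delta_mx ord0 i + x) y).
    by apply/(is_derive_lineP (f ^~ y)); exact: fdf.
  have tx (t : R) : t \in `]-1, 1[ -> `|t *: delta_mx ord0 i + x| <= `|x| + 1.
    rewrite in_itv/= => /andP[t1 t2].
    rewrite addrC; apply: le_trans (ler_normD _ _) _; rewrite lerD2l normrZ.
    rewrite -[leRHS]mulr1 ler_pM ?norm_delta_mx_le1// ler_norml; lra.
  have I0 : `]-1, 1[%classic (0 : R) by rewrite /= in_itv/=; lra.
  have hint (t : R) : `]-1, 1[%classic t -> mu.-integrable [set: T] (EFin \o h t).
    by move=> /= /tx tM; exact: (int_f _ _ _ ig fg).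
  have g0 y : 0 <= g y.
    by have [h1 _] := fg x y (ltac:(by rewrite lerDl)); exact: le_trans h1.
  have hder (t : R) y : `]-1, 1[%classic t -> [set: T] y -> derivable (h ^~ y) t 1.
    by move=> _ _; have [] := hd t y.
  have d1E (t : R) y : partial1of2 h t y = df i (t *: delta_mx ord0 i + x) y.
    by rewrite partial1of2E; have [_ ->] := hd t y.
  have gub (t : R) y : `]-1, 1[%classic t -> [set: T] y -> `|partial1of2 h t y| <= g y.
    by move=> /= /tx tM _; rewrite d1E; have [_ ->] := fg _ y tM.
  have D := derivable_under_integral measurableT I0 hint hder g0 ig gub.
  have E := differentiation_under_integral measurableT I0 hint hder g0 ig gub.
  have : is_derive (0 : R) 1 (fun t : R => \int[mu]_y h t y) (\int[mu]_y df i x y).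
    apply: DeriveDef => //; rewrite -derive1E E.
    by apply: eq_Rintegral => y _; rewrite d1E scale0r add0r.
  move/(is_derive_lineP (fun x => \int[mu]_y f x y)).
  by rewrite scale0r add0r.
split; first by move=> x; have [] := H x.
split => //.
have -> : 'D_(delta_mx ord0 i) (fun x => \int[mu]_y f x y) = (fun x => \int[mu]_y df i x y).
  by apply/funext => x; have [_ ->] := H x.
apply: continuous_parametric_integral => // M; have [g ig fg] := dom M.
by exists g => // x y xM; have [_] := fg x y xM; exact.
Qed.

End parametric_integral.

(** * Lebesgue measure: isometries and integrable powers *)

Lemma continuous_measurable_rV (R : realType) n (f : 'rV[R]_n -> R) :
  continuous f -> measurable_fun [set: 'rV[R]_n] f.
Proof.
move=> /continuousP cf; apply: (measurability _ (RGenOpens.measurableE R)).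
move=> _ [_ [a [b ->] <-]]; rewrite setTI; apply: open_measurable_rV.
exact/cf/interval_open.
Qed.

Lemma measurable_Ck (R : realType) n k (f : 'rV[R]_n -> R) : Ck k f -> measurable_fun [set: 'rV[R]_n] f.
Proof. by move=> Cf; apply: continuous_measurable_rV; exact: Ck_continuous Cf. Qed.

Lemma integrable_dominated d (T : measurableType d) (R : realType)
    (mu : {measure set T -> \bar R}) (f g : T -> R) :
  measurable_fun [set: T] f -> (forall x, `|f x| <= g x) ->
  mu.-integrable [set: T] (EFin \o g) -> mu.-integrable [set: T] (EFin \o f).
Proof.
move=> mf fg; apply: le_integrable => //; first exact/measurable_EFinP.
by move=> x _; rewrite lee_fin (le_trans (fg x))// ler_norm.
Qed.

Lemma integrable_of_ge0 d (T : measurableType d) (R : realType)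
    (mu : {measure set T -> \bar R}) (f : T -> R) :
  measurable_fun [set: T] f -> (forall x, 0 <= f x) ->
  (\int[mu]_x (f x)%:E < +oo)%E -> mu.-integrable [set: T] (EFin \o f).
Proof.
move=> mf f0 fi; apply/integrableP; split; first exact/measurable_EFinP.
apply: le_lt_trans fi; rewrite le_eqVlt; apply/orP; left; apply/eqP.
by apply: eq_integral => x _ /=; rewrite ger0_norm.
Qed.

Section isometry_invariance.
Context {R : realType}.

(** x |-> a + x, or x |-> a - x when b holds. *)
Definition flip_shift n (b : bool) (a : 'rV[R]_n) (x : 'rV[R]_n) : 'rV[R]_n :=
  (-1) ^+ b *: x + a.

Lemma measurable_flip_shift n b (a : 'rV[R]_n) :
  measurable_fun [set: 'rV[R]_n] (flip_shift b a).
Proof.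
apply: measurable_fun_rVP => i; under eq_fun do rewrite !mxE.
apply: measurable_funD => //; apply: measurable_funM => //.
exact: measurable_coord_rV.
Qed.

Definition flip_shift1 (b : bool) (a t : R) : R := (-1) ^+ b * t + a.

Lemma measurable_flip_shift1 (b : bool) (a : R) :
  measurable_fun [set: measurableTypeR R] (flip_shift1 b a : measurableTypeR R -> measurableTypeR R).
Proof. by apply: measurable_funD => //; apply: measurable_funM. Qed.

(** The preimage of an interval is an interval of the same length, possibly
    closed at the other end. *)
Lemma lebesgue_measure_flip_shift (b : bool) (a : R) (A : set R) : measurable A ->
  lebesgue_measure (flip_shift1 b a @^-1` A) = lebesgue_measure A.
Proof.
move=> mA.
pose m := measure_function_pushforward__canonical__measure_function_Measure
  (@lebesgue_measure R) (measurable_flip_shift1 b a).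
apply/esym; apply: (@lebesgue_measure_unique R m) => // X [[x y] /= _ <-].
rewrite /m/= /pushforward; clear m.
have -> : flip_shift1 b a @^-1` `]x, y] =
   [set` if b then `[a - y, a - x[ else `]x - a, y - a]].
  apply/seteqP; split => t; rewrite /flip_shift1 /=; case: b => /=;
    rewrite ?expr1 ?expr0 !in_itv/= => /andP[? ?]; apply/andP; split; lra.
rewrite !lebesgue_measure_itv/=; case: b => /=; rewrite !lte_fin.
  have -> : (a - y < a - x) = (x < y) by apply/idP/idP => ?; lra.
  by case: ifP => // _; rewrite -!EFinB; congr (_%:E); lra.
have -> : (x - a < y - a) = (x < y) by apply/idP/idP => ?; lra.
by case: ifP => // _; rewrite -!EFinB; congr (_%:E); lra.
Qed.

(** Under the identification of R^(n+1) with R x R^n the map is a product of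
    maps of the same kind; both sides are measures that agree on rectangles. *)
Lemma lebesgue_rV_flip_shift n b (a : 'rV[R]_n) A : measurable A ->
  lebesgue_rV R n (flip_shift b a @^-1` A) = lebesgue_rV R n A.
Proof.
elim: n a A => [|n IH] a A mA.
  congr (lebesgue_rV R 0 _); apply/seteqP; split => x /=;
    by rewrite (_ : flip_shift b a x = x)//; apply/rowP => -[].
pose a1 := (uncons_rV a).1; pose a2 := (uncons_rV a).2.
pose T2 (z : measurableTypeR R * 'rV[R]_n) : measurableTypeR R * 'rV[R]_n :=
  (flip_shift1 b a1 z.1, flip_shift b a2 z.2).
have mT2 : measurable_fun [set: _] T2.
  apply: measurable_fun_pair.
  - by apply: (measurableT_comp (measurable_flip_shift1 b a1)).
  - by apply: (measurableT_comp (measurable_flip_shift b a2)).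
have consT z : flip_shift b a (cons_rV z) = cons_rV (T2 z).
  apply/rowP => i; rewrite !mxE; case: unliftP => [j|] ->/=.
    by rewrite !mxE.
  by [].
rewrite /= /lebesgue_rVS /pushforward.
have -> : @cons_rV R n @^-1` (flip_shift b a @^-1` A) = T2 @^-1` (@cons_rV R n @^-1` A).
  by apply/seteqP; split => z /=; rewrite consT.
have mcA : measurable (@cons_rV R n @^-1` A).
  by rewrite -[X in measurable X]setTI; apply: measurable_cons_rV.
pose m' := measure_function_pushforward__canonical__measure_function_Measure
  (product_measure1 (@lebesgue_measure R) (lebesgue_rV R n)) mT2.
apply/esym.
apply: (@product_measure_unique _ _ _ _ R (@lebesgue_measure R) (lebesgue_rV R n) m') => //.
move=> B D mB mD; rewrite /= /pushforward.
have -> : T2 @^-1` (B `*` D) = (flip_shift1 b a1 @^-1` B) `*` (flip_shift b a2 @^-1` D).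
  by [].
have m1 : measurable (flip_shift1 b a1 @^-1` B).
  by rewrite -[X in measurable X]setTI; apply: measurable_flip_shift1.
have m2 : measurable (flip_shift b a2 @^-1` D).
  by rewrite -[X in measurable X]setTI; apply: measurable_flip_shift.
rewrite product_measure1E//.
by congr (_ * _)%E; [exact: lebesgue_measure_flip_shift|exact: IH].
Qed.

Let integral_pushforward_flip_shift n b (a : 'rV[R]_n) (f : 'rV[R]_n -> \bar R) :
  (\int[pushforward (lebesgue_rV R n) (flip_shift b a)]_x f x =
   \int[lebesgue_rV R n]_x f x)%E.
Proof.
pose m := measure_function_pushforward__canonical__measure_function_Measure
  (lebesgue_rV R n) (measurable_flip_shift b a).
apply: (@eq_measure_integral _ _ _ _ (lebesgue_rV R n) m).
by move=> A mA _; exact: lebesgue_rV_flip_shift.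
Qed.

Lemma integrable_flip_shift n b (a : 'rV[R]_n) (f : 'rV[R]_n -> \bar R) :
  (lebesgue_rV R n).-integrable [set: 'rV[R]_n] f ->
  (lebesgue_rV R n).-integrable [set: 'rV[R]_n] (f \o flip_shift b a).
Proof.
move=> /integrableP[mf fi]; apply/integrableP; split.
  exact: (measurableT_comp mf (measurable_flip_shift b a)).
apply: le_lt_trans fi.
rewrite -(integral_pushforward_flip_shift b a (fun x => `|f x|)%E)//.
rewrite ge0_integral_pushforward//.
- exact: measurable_flip_shift.
- exact: measurableT_comp.
Qed.

Lemma integral_flip_shift n b (a : 'rV[R]_n) (f : 'rV[R]_n -> \bar R) :
  (lebesgue_rV R n).-integrable [set: 'rV[R]_n] f ->
  (\int[lebesgue_rV R n]_x f (flip_shift b a x) = \int[lebesgue_rV R n]_x f x)%E.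
Proof.
move=> fi; rewrite -[RHS](integral_pushforward_flip_shift b a).
rewrite integral_pushforward//.
- exact: measurable_flip_shift.
- exact: measurable_int fi.
- exact: integrable_flip_shift.
Qed.

End isometry_invariance.

Section dyadic.
Context {R : realType} {n : nat}.
Notation mu := (lebesgue_rV R n).

Definition cube (r : R) : set 'rV[R]_n :=
  [set x | forall i, x ord0 i \in `[- r, r]].

Lemma measurable_cube r : measurable (cube r).
Proof.
rewrite (_ : cube r = \bigcap_(i in setT)
    [set x : 'rV[R]_n | x ord0 i \in `[- r, r]]).
  apply: fin_bigcap_measurable => // i _.
  rewrite -[X in measurable X]setTI.
  exact: (@measurable_coord_rV R n i measurableT _ (measurable_itv _)).
by apply/seteqP; split => [x qx i _|x qx i]; [exact: qx|exact: (qx i I)].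
Qed.

Lemma lebesgue_cube r : 0 <= r -> mu (cube r) = ((2 * r) ^+ n)%:E.
Proof.
move=> r0; rewrite (@lebesgue_rV_box R n (fun=> [set` `[- r, r]]))//.
rewrite (eq_bigr (fun=> (2 * r)%:E)) ?prodEFin ?prodr_const ?card_ord//.
move=> i _; rewrite lebesgue_measure_itv/= lte_fin.
case: ifPn => [_|]; first by rewrite -EFinB; congr (_%:E); lra.
by rewrite -leNgt => rr; congr (_%:E); lra.
Qed.

(** f is at most the series of the functions a_k 1_(cube of half-side r_k), whose
    integral is a convergent geometric series. *)
Lemma dyadic_integral_lty (f : 'rV[R]_n -> R) (a r : nat -> R) (c q : R) :
  measurable_fun [set: 'rV[R]_n] f -> (forall x, 0 <= f x) ->
  (forall k, 0 <= a k) -> (forall k, 0 <= r k) -> 0 <= q < 1 ->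
  (forall x, f x != 0 -> exists k, `|x| <= r k /\ f x <= a k) ->
  (forall k, a k * (2 * r k) ^+ n <= c * q ^+ k) ->
  (\int[mu]_x (f x)%:E < +oo)%E.
Proof.
move=> mf f0 a0 r0 /andP[q0 q1] fa ac.
pose g k x : \bar R := (a k * \1_(cube (r k)) x)%:E.
have g0 k x : (0 <= g k x)%E by rewrite lee_fin mulr_ge0.
have mg k : measurable_fun [set: 'rV[R]_n] (g k).
  apply/measurable_EFinP; apply: measurable_funM => //.
  by apply: measurable_indic; exact: measurable_cube.
have fg x : ((f x)%:E <= \sum_(0 <= k <oo) g k x)%E.
  have [->|/fa[k [xk fk]]] := eqVneq (f x) 0; first exact: nneseries_ge0.
  apply: le_trans (nneseries_lim_ge k.+1 (fun j _ _ => g0 j x)).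
  rewrite big_nat_recr//=; apply: le_trans (leeDr _ _); last by apply: sume_ge0.
  rewrite lee_fin /g indicE mem_set ?mulr1// => i.
  by rewrite in_itv/= -ler_norml (le_trans (coord_le_norm x i)).
apply: le_lt_trans (_ : (\int[mu]_x (\sum_(0 <= k <oo) g k x) < +oo)%E).
  apply: ge0_le_integral => //.
  - by move=> x _; rewrite lee_fin.
  - exact/measurable_EFinP.
  - exact: ge0_emeasurable_sum.
rewrite integral_nneseries//.
have gE k : (\int[mu]_x g k x = (a k * (2 * r k) ^+ n)%:E)%E.
  rewrite /g; under eq_integral do rewrite EFinM.
  have mc : measurable_fun [set: 'rV[R]_n] (fun x => (\1_(cube (r k)) x)%:E : \bar R).
    by apply/measurable_EFinP; apply: measurable_indic; exact: measurable_cube.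
  rewrite ge0_integralZl ?lee_fin//.
  have mk := measurable_cube (r k).
  by rewrite integral_indic// setIT EFinM -lebesgue_cube.
apply: le_lt_trans (_ : ((c / (1 - q))%:E < +oo)%E); last by rewrite ltry.
have c0 : 0 <= c.
  by have := ac 0%N; rewrite expr0 mulr1; apply: le_trans; rewrite mulr_ge0// exprn_ge0// mulr_ge0.
apply: lime_le; first by apply: is_cvg_nneseries => k _ _; exact: integral_ge0.
apply: nearW => N; under eq_bigr do rewrite gE.
rewrite sumEFin lee_fin.
apply: le_trans (_ : series (geometric c q) N <= _).
  by rewrite /series/= !big_mkord; apply: ler_sum => k _; exact: ac.
have qn : `|q| < 1 by rewrite ger0_norm.
rewrite -(cvg_lim (@Rhausdorff R) (@cvg_geometric_series R c q qn)).
apply: nondecreasing_cvgn_le; last exact: is_cvg_geometric_series.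
by apply: nondecreasing_series => k _ _; rewrite /geometric/= mulr_ge0// exprn_ge0.
Qed.

End dyadic.

Section integrable_powers.
Context {R : realType} {n : nat}.
Notation mu := (lebesgue_rV R n).

Lemma dyadic_scale (t : R) : 1 <= t -> exists k : nat, 2 ^+ k <= t < 2 ^+ k.+1.
Proof.
move=> t1.
have ex : exists k : nat, t < 2 ^+ k.
  have [k tk] : exists k : nat, t < k%:R.
    by exists (Num.truncn t).+1; exact: truncnS_gt.
  exists k; apply: lt_le_trans tk _.
  by rewrite -natrX ler_nat ltnW// ltn_expl.
case: (ex_minnP ex) => -[|k] tk kmin; first by move: tk; rewrite expr0; lra.
exists k; rewrite tk andbT leNgt; apply/negP => /kmin.
by rewrite ltnn.
Qed.

Lemma measurable_norm_rV : measurable_fun [set: 'rV[R]_n] (fun x => `|x|).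
Proof. by apply: continuous_measurable_rV => x; exact: norm_continuous. Qed.

(** The model singularity |x|^b at the origin; at 0 its value is that of the
    power function, which is 0 or 1. *)
Definition near_power (b : R) (x : 'rV[R]_n) : R :=
  if `|x| < 1 then `|x| `^ b else 0.

Lemma near_power_ge0 b x : 0 <= near_power b x.
Proof. by rewrite /near_power; case: ifP => // _; exact: powR_ge0. Qed.

Lemma measurable_near_power b : measurable_fun [set: 'rV[R]_n] (near_power b).
Proof.
apply: measurable_fun_ifT => //.
  apply: measurable_fun_ltr => //; exact: measurable_norm_rV.
by apply: (measurableT_comp (measurable_powR _)); exact: measurable_norm_rV.
Qed.

(** On the shell 2^-(k+1) <= |x| <= 2^-k the function is at most
    2^|b| 2^(-bk), and the shell has measure at most 2^n 2^(-nk). *)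
Lemma integrable_near_power (b : R) : - n%:R < b ->
  mu.-integrable [set: 'rV[R]_n] (EFin \o near_power b).
Proof.
move=> nb; apply: integrable_of_ge0; [exact: measurable_near_power|exact: near_power_ge0|].
apply: (@dyadic_integral_lty R n (near_power b)
  (fun k => 2 `^ `|b| * (2 `^ (- b)) ^+ k) (fun k => 2^-1 ^+ k)
  (2 `^ `|b| * 2 ^+ n) (2 `^ (- b) / 2 ^+ n)).
- exact: measurable_near_power.
- exact: near_power_ge0.
- by move=> k; rewrite mulr_ge0 ?exprn_ge0 ?powR_ge0.
- by move=> k; rewrite exprn_ge0 ?invr_ge0.
- rewrite divr_ge0 ?powR_ge0//= ltr_pdivrMr ?exprn_gt0// mul1r.
  by rewrite -powR_mulrn// ltr_powR2r; lra.
- move=> x; rewrite /near_power; case: ifPn => [x1 _|]; last by rewrite eqxx.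
  have [x0|x0] := eqVneq `|x| 0.
    exists 0%N; rewrite x0 !expr0 mulr1; split => //.
    apply: (@le_trans _ _ (1 : R)); last by rewrite -[leLHS](powRr0 2) ler_powR// ler1n.
    have [->|b0] := eqVneq b 0; first by rewrite powRr0.
    by rewrite powR0.
  have xp : 0 < `|x| by rewrite lt0r x0/=.
  have [k /andP[k1 k2]] := @dyadic_scale `|x|^-1 (ltac:(by rewrite invf_ge1// ltW)).
  exists k; split.
    by rewrite exprVn -[leLHS]invrK lef_pV2 ?posrE ?invr_gt0 ?exprn_gt0.
  (* Factor out the scale 2^-k: the base of the first power lies in [1, 2]. *)
  have -> : `|x| `^ b = (`|x|^-1 / 2 ^+ k) `^ (- b) * (2 `^ (- b)) ^+ k.
    rewrite -powR_exprn// -powRM ?divr_ge0 ?invr_ge0 ?exprn_ge0//.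
    by rewrite divfK ?expf_neq0// powRN -powR_inv1// -powRAC powR_inv1 ?powR_ge0// invrK.
  rewrite ler_wpM2r ?exprn_ge0 ?powR_ge0//.
  have s1 : 1 <= `|x|^-1 / 2 ^+ k by rewrite ler_pdivlMr ?mul1r// exprn_gt0.
  apply: le_trans (ler_powR s1 (_ : _ <= `|b|)) _; first by rewrite lerNl lerNnormlW.
  rewrite ge0_ler_powR ?nnegrE ?(le_trans ler01 s1)//.
  by rewrite ler_pdivrMr ?exprn_gt0// -exprS ltW.
- move=> k; rewrite exprMn -exprM (mulnC k) exprM.
  rewrite !exprVn expr_div_n le_eqVlt; apply/orP; left; apply/eqP; ring.
Qed.

(** On the shell 2^k <= |x| <= 2^(k+1) the function is at most 2^(-2 al k), and
    the shell has measure at most 4^n 2^(nk). *)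
Lemma integrable_bracket (al : R) : n%:R < 2 * al ->
  mu.-integrable [set: 'rV[R]_n] (EFin \o (fun x => (1 + `|x| ^+ 2) `^ (- al))).
Proof.
move=> nal.
have mf : measurable_fun [set: 'rV[R]_n] (fun x => (1 + `|x| ^+ 2) `^ (- al)).
  apply: (measurableT_comp (measurable_powR _)).
  apply: measurable_funD => //; apply: measurable_funX; exact: measurable_norm_rV.
apply: integrable_of_ge0 => //.
have al0 : 0 <= al by have := ler0n R n; lra.
apply: (@dyadic_integral_lty R n _
  (fun k => (2 `^ (- (2 * al))) ^+ k) (fun k => 2 * 2 ^+ k)
  (4 ^+ n) (2 `^ (- (2 * al)) * 2 ^+ n)) => [//|//|k|k| |x _|k].
- by rewrite exprn_ge0 ?powR_ge0.
- by rewrite mulr_ge0 ?exprn_ge0.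
- rewrite mulr_ge0 ?powR_ge0 ?exprn_ge0//= -powR_mulrn// -powRD ?pnatr_eq0 ?implybT//.
  by rewrite -[ltRHS](powRr0 2) ltr_powR2r; lra.
- have [x1|x1] := ltP `|x| 1.
    exists 0%N; rewrite !expr0 mulr1; split; first lra.
    by rewrite powRN invf_le1 ?powR_gt0 ?ltr_wpDr ?sqr_ge0// -[leLHS](powRr0 (1 + `|x| ^+ 2)) ler_powR// lerDl sqr_ge0.
  have [k /andP[k1 k2]] := dyadic_scale x1.
  exists k; split; first by rewrite -exprS ltW.
  rewrite -powR_exprn// !powRN lef_pV2 ?posrE ?powR_gt0 ?exprn_gt0 ?ltr_wpDr ?sqr_ge0//.
  have h2 : 0 <= 2 ^+ k :> R by rewrite exprn_ge0.
  rewrite powRrM (powR_mulrn 2 h2) ge0_ler_powR ?nnegrE ?addr_ge0 ?sqr_ge0//.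
  apply: le_trans (_ : `|x| ^+ 2 <= _); last by rewrite lerDr.
  by rewrite ler_sqr ?nnegrE.
- rewrite mulrA [in leLHS]exprMn [in leRHS]exprMn -[in leLHS]exprM (mulnC k n) exprM.
  rewrite (_ : 2 * 2 = 4 :> R); last by ring.
  by rewrite mulrCA.
Qed.

End integrable_powers.

(** * Euclidean norm and splitting of the kernel *)

Section euclidean_norm.
Context {R : realType} {n : nat}.
Implicit Types x y z : 'rV[R]_n.

(** The squared Euclidean norm, kept apart from [enorm] because it is a
    polynomial, hence differentiable at the origin too. *)
Definition sqnorm x : R := \sum_(i < n) x ord0 i ^+ 2.

Lemma sqnorm_ge0 x : 0 <= sqnorm x.
Proof. by apply: sumr_ge0 => i _; exact: sqr_ge0. Qed.

Lemma enorm_ge0 x : 0 <= enorm x.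
Proof. exact: sqrtr_ge0. Qed.

Lemma sqr_enorm x : enorm x ^+ 2 = sqnorm x.
Proof. by rewrite sqr_sqrtr// sqnorm_ge0. Qed.

Lemma enorm_powR x a : enorm x `^ (2 * a) = sqnorm x `^ a.
Proof. by rewrite powRrM (powR_mulrn 2 (enorm_ge0 x)) sqr_enorm. Qed.

Lemma sqr_coord_le x i : x ord0 i ^+ 2 <= sqnorm x.
Proof. by rewrite /sqnorm (bigD1 i)//= lerDl sumr_ge0// => j _; exact: sqr_ge0. Qed.

Lemma norm_le_enorm x : `|x| <= enorm x.
Proof.
apply: rV_norm_le; first exact: enorm_ge0.
by move=> i; rewrite -sqrtr_sqr ler_wsqrtr// sqr_coord_le.
Qed.

Lemma sqr_norm_le x : `|x| ^+ 2 <= sqnorm x.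
Proof. by rewrite -sqr_enorm ler_sqr ?nnegrE ?enorm_ge0// norm_le_enorm. Qed.

Lemma sqnormN x : sqnorm (- x) = sqnorm x.
Proof. by apply: eq_bigr => i _; rewrite mxE sqrrN. Qed.

Lemma enormN x : enorm (- x) = enorm x.
Proof. by congr Num.sqrt; exact: sqnormN. Qed.

Lemma sqnorm_le_norm x (M : R) : `|x| <= M -> sqnorm x <= n%:R * M ^+ 2.
Proof.
move=> xM; rewrite mulr_natl -[n in leRHS]card_ord -sumr_const; apply: ler_sum => i _.
rewrite -real_normK ?num_real// ler_sqr ?nnegrE ?(le_trans (coord_le_norm _ _))//.
by rewrite (le_trans _ xM).
Qed.

(** From |y|^2 <= 2 |x|^2 + 2 |x - y|^2. *)
Lemma sqnorm_le_split x y : 1 + sqnorm y <= 2 * (1 + sqnorm x) * (1 + sqnorm (x - y)).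
Proof.
have H : sqnorm y <= 2 * sqnorm x + 2 * sqnorm (x - y).
  rewrite /sqnorm !mulr_sumr -big_split/=; apply: ler_sum => i _.
  by rewrite !mxE -subr_ge0; have := sqr_ge0 (y ord0 i - 2 * x ord0 i); lra.
have := sqnorm_ge0 x; have := sqnorm_ge0 (x - y); nra.
Qed.

Lemma continuous_sqnorm : continuous sqnorm.
Proof.
apply: continuous_big => [|i _]; first exact: add_continuous.
by apply: continuous_mul; exact: continuous_coord.
Qed.

Lemma continuous_enorm : continuous (@enorm R n).
Proof.
move=> x; apply: (@cvg_comp _ _ _ sqnorm Num.sqrt _ (nbhs (sqnorm x))).
  exact: continuous_sqnorm.
exact: sqrt_continuous.
Qed.

Lemma is_derive_sqnorm (i : 'I_n) x :
  is_derive x (delta_mx ord0 i) sqnorm (2 * x ord0 i).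
Proof.
have E t : sqnorm (t *: delta_mx ord0 i + x) =
    sqnorm x + (2 * x ord0 i * t + t ^+ 2).
  rewrite /sqnorm (bigD1 i)//= [in RHS](bigD1 i)//= !mxE !eqxx/=.
  under eq_bigr => j ji do rewrite !mxE (negbTE ji) andbF mulr0 add0r.
  ring.
have -> : x = 0 *: delta_mx ord0 i + x by rewrite scale0r add0r.
apply/(is_derive_lineP sqnorm x).
rewrite scale0r add0r; under eq_fun do rewrite E.
apply: is_derive_eq.
by rewrite /GRing.scale/=; ring.
Qed.

End euclidean_norm.

Section cutoff.
Context {R : realType}.
Implicit Types t : R.

(** This is t + max(1 - t, 0)^2, the square of the positive part being written
    (v^2 + |v| v) / 2 with v = 1 - t to make its differentiability apparent. It
    equals t for t >= 1 and stays away from 0 on the half-line t >= 0, so that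
    its negative powers are C^1 there. *)
Definition cutoff t : R := t + ((1 - t) ^+ 2 + sgnpow 1 (1 - t)) / 2.

Lemma cutoff_ge1 t : 1 <= t -> cutoff t = t.
Proof.
move=> t1; rewrite /cutoff /sgnpow powRr1// ler0_norm; last lra.
by ring.
Qed.

Lemma cutoff_le1 t : t <= 1 -> cutoff t = t + (1 - t) ^+ 2.
Proof.
move=> t1; rewrite /cutoff /sgnpow powRr1// ger0_norm; last lra.
by field.
Qed.

Lemma cutoff_ge t : 0 <= t -> (1 + t) / 3 <= cutoff t.
Proof.
move=> t0; have [t1|/ltW t1] := leP 1 t; first by rewrite cutoff_ge1//; lra.
(* The difference of the two sides is (t - 2/3)^2 + 2/9. *)
rewrite cutoff_le1//; have := sqr_ge0 (t - 2/3); nra.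
Qed.

Lemma cutoff_gt0 t : 0 <= t -> 0 < cutoff t.
Proof. by move=> t0; have := cutoff_ge t0; lra. Qed.

Lemma cutoff_le t : 0 <= t -> cutoff t <= 1 + t.
Proof.
move=> t0; have [t1|/ltW t1] := leP 1 t; first by rewrite cutoff_ge1//; lra.
by rewrite cutoff_le1//; nra.
Qed.

Definition dcutoff t : R := t - `|1 - t|.

Lemma is_derive_cutoff t : is_derive t 1 cutoff (dcutoff t).
Proof.
have H : is_derive t 1 (fun t : R => 1 - t) (-1).
  by apply: is_derive_eq; rewrite add0r mul1r.
have := @is_derive1_comp R (sgnpow 1) (fun t : R => 1 - t) t _ _ (is_derive_sgnpow (1 - t) ltr01) H.
rewrite powRr1//= => H2.
rewrite /cutoff /dcutoff; apply: is_derive_eq.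
by rewrite /GRing.scale/=; field.
Qed.

Lemma norm_dcutoff_le1 t : 0 <= t -> `|dcutoff t| <= 1.
Proof.
move=> t0; rewrite /dcutoff ler_norml; have [t1|/ltW t1] := leP 1 t.
  by rewrite ler0_norm; [apply/andP; split; lra|lra].
by rewrite ger0_norm; [apply/andP; split; lra|lra].
Qed.

Lemma continuous_cutoff : continuous cutoff.
Proof.
move=> t; apply/differentiable_continuous/derivable1_diffP.
by have [] := is_derive_cutoff t.
Qed.

Lemma continuous_dcutoff : continuous dcutoff.
Proof.
move=> t; apply: cvgB; first exact: cvg_id.
by apply: cvg_norm; apply: cvgB; [exact: cvg_cst|exact: cvg_id].
Qed.

End cutoff.

Section kernels.
Context {R : realType} {n : nat}.
Variable al : R.
Hypothesis al0 : 0 < al.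
Implicit Types x y z : 'rV[R]_n.

Definition kernel x : R := enorm x `^ (- (2 * al)).
(** The kernel is the negative power - al of |x|^2; here |x|^2 is replaced by its
    cutoff, which removes the singularity and changes nothing when |x| >= 1. *)
Definition far_kernel x : R := cutoff (sqnorm x) `^ (- al).
Definition near_kernel x : R := kernel x - far_kernel x.

Definition dfar_kernel (i : 'I_n) x : R :=
  - al * cutoff (sqnorm x) `^ (- al - 1) * (dcutoff (sqnorm x) * (2 * x ord0 i)).

Let W x : R := (1 + sqnorm x) `^ (- al).

Lemma kernelE x : kernel x = sqnorm x `^ (- al).
Proof. by rewrite /kernel -mulrN enorm_powR. Qed.

Lemma cutoff_sqnorm_gt0 x : 0 < cutoff (sqnorm x).
Proof. exact/cutoff_gt0/sqnorm_ge0. Qed.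

Lemma far_kernel_gt0 x : 0 < far_kernel x.
Proof. by rewrite powR_gt0// cutoff_sqnorm_gt0. Qed.

Lemma near_kernelN x : near_kernel (- x) = near_kernel x.
Proof. by rewrite /near_kernel !kernelE /far_kernel sqnormN. Qed.

Lemma near_kernel_support x : 1 <= enorm x -> near_kernel x = 0.
Proof.
move=> x1; rewrite /near_kernel kernelE /far_kernel cutoff_ge1 ?subrr//.
by rewrite -sqr_enorm expr_ge1// enorm_ge0.
Qed.

Lemma norm_near_kernel_le x : x != 0 -> `|x| < 1 ->
  `|near_kernel x| <= (1 + 3 `^ al) * `|x| `^ (- (2 * al)).
Proof.
move=> x0 x1; have nx0 : 0 < `|x| by rewrite normr_gt0.
apply: le_trans (ler_normB _ _) _.
rewrite !ger0_norm ?powR_ge0// mulrDl mul1r lerD//.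
  apply: powRN_le => //; last exact: norm_le_enorm.
  by rewrite mulr_ge0// ltW.
apply: le_trans (_ : 3 `^ al * 1 <= _).
  have c3 : 3^-1 <= cutoff (sqnorm x).
    by have := cutoff_ge (sqnorm_ge0 x); have := sqnorm_ge0 x; lra.
  have h3 : (0 : R) < 3^-1 by rewrite invr_gt0.
  apply: le_trans (powRN_le (ltW al0) h3 c3) _.
  by rewrite mulr1 powR_invN.
rewrite ler_wpM2l ?powR_ge0// -(powRr0 `|x|).
apply: ger_powR; first by rewrite nx0 ltW.
by rewrite oppr_le0 mulr_ge0// ltW.
Qed.

(** Away from the origin the two kernels are comparable, since the cutoff of
    v = |x|^2 is at most 1 + v <= (e^-2 + 1) v. *)
Lemma kernel_le_far (e : R) : 0 < e -> exists2 c : R, 0 <= c &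
  forall x, e <= enorm x -> kernel x <= c * far_kernel x.
Proof.
move=> e0; exists ((1 / e ^+ 2 + 1) `^ al); first exact: powR_ge0.
move=> x ex; rewrite kernelE /far_kernel.
have e2 : e ^+ 2 <= sqnorm x by rewrite -sqr_enorm ler_sqr ?nnegrE ?enorm_ge0// ltW.
have e20 : 0 < e ^+ 2 by rewrite exprn_gt0.
have s0 : 0 < sqnorm x by exact: lt_le_trans e2.
have c0 : 0 < 1 / e ^+ 2 + 1 by rewrite ltr_wpDl// divr_ge0// ltW.
have -> : sqnorm x `^ (- al) =
    (1 / e ^+ 2 + 1) `^ al * ((1 / e ^+ 2 + 1) * sqnorm x) `^ (- al).
  exact: powR_cancel (ltW s0).
rewrite ler_wpM2l ?powR_ge0//; apply: powRN_le; [exact: ltW|exact: cutoff_sqnorm_gt0|].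
apply: le_trans (cutoff_le (ltW s0)) _.
by rewrite mulrDl (mul1r (sqnorm x)) lerD2r mul1r mulrC ler_pdivlMr// mul1r.
Qed.

Lemma continuous_cutoff_sqnorm : continuous (fun x : 'rV[R]_n => cutoff (sqnorm x)).
Proof. exact: continuous_compose continuous_sqnorm continuous_cutoff. Qed.

Lemma continuous_far_kernel : continuous far_kernel.
Proof.
apply: continuous_powR_pos; [exact: continuous_cutoff_sqnorm|exact: cutoff_sqnorm_gt0].
Qed.

Lemma continuous_dfar_kernel i : continuous (dfar_kernel i).
Proof.
apply: continuous_mul; apply: continuous_mul.
- exact: continuous_const.
- apply: continuous_powR_pos; [exact: continuous_cutoff_sqnorm|exact: cutoff_sqnorm_gt0].
- exact: continuous_compose continuous_sqnorm continuous_dcutoff.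
- by apply: continuous_mul; [exact: continuous_const|exact: continuous_coord].
Qed.

Lemma is_derive_far_kernel i x :
  is_derive x (delta_mx ord0 i) far_kernel (dfar_kernel i x).
Proof.
apply: (@is_derive_comp1 R _ (fun t => t `^ (- al)) (fun x => cutoff (sqnorm x))).
  exact/is_derive1_powR/cutoff_sqnorm_gt0.
apply: is_derive_comp1; [exact: is_derive_cutoff|exact: is_derive_sqnorm].
Qed.

(** Differentiating costs the factor 2 |x_i| <= 1 + |x|^2 <= 3 cutoff(|x|^2),
    which compensates the loss of one power of the cutoff. *)
Lemma norm_dfar_kernel_le i x : `|dfar_kernel i x| <= 3 * al * far_kernel x.
Proof.
have s0 := sqnorm_ge0 x.
have c0 := cutoff_sqnorm_gt0 x.
rewrite /dfar_kernel !normrM normrN (ger0_norm (powR_ge0 _ _)) (gtr0_norm al0).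
rewrite [`|2|]ger0_norm//.
have -> : 3 * al * far_kernel x =
    al * cutoff (sqnorm x) `^ (- al - 1) * (3 * cutoff (sqnorm x)).
  rewrite /far_kernel -[in LHS](subrK 1 (- al)) [in LHS]powRD; last first.
    by rewrite (gt_eqF c0) implybT.
  rewrite powRr1 ?(ltW c0)//; ring.
rewrite ler_wpM2l//; first by rewrite mulr_ge0 ?powR_ge0// ltW.
apply: le_trans (_ : 1 * (2 * `|x ord0 i|) <= _).
  by rewrite ler_wpM2r ?mulr_ge0// norm_dcutoff_le1.
rewrite mul1r.
have := cutoff_ge s0; have := sqr_coord_le x i; have := sqr_ge0 (`|x ord0 i| - 1).
rewrite -(@real_normK _ (x ord0 i)) ?num_real//; nra.
Qed.

Lemma far_kernel_le x : far_kernel x <= 3 `^ al * W x.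
Proof.
have s0 := sqnorm_ge0 x.
have h3 : (0 : R) < 3 by [].
have -> : 3 `^ al * W x = ((1 + sqnorm x) / 3) `^ (- al).
  rewrite /W powRM ?invr_ge0// ?addr_ge0// mulrC; congr (_ * _).
  by rewrite powR_invN.
apply: powRN_le; [exact: ltW|by rewrite divr_gt0// ltr_wpDr|exact: cutoff_ge].
Qed.

(** By [sqnorm_le_split] the dependence on x of the far kernel at x - y is a
    bounded factor as long as x is bounded. *)
Lemma far_kernel_translate_le (M : R) : exists2 c : R, 0 <= c &
  forall x y, `|x| <= M -> far_kernel (x - y) <= c * W y.
Proof.
pose S := 2 * (1 + n%:R * M ^+ 2).
exists (3 `^ al * S `^ al); first by rewrite mulr_ge0 ?powR_ge0.
move=> x y xM; apply: le_trans (far_kernel_le _) _; rewrite -mulrA ler_wpM2l ?powR_ge0//.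
have S0 : 0 < S by rewrite mulr_gt0// ltr_wpDr// mulr_ge0// sqr_ge0.
have s1 := sqnorm_ge0 (x - y); have s2 := sqnorm_ge0 y.
have yS : 1 + sqnorm y <= S * (1 + sqnorm (x - y)).
  apply: le_trans (sqnorm_le_split x y) _.
  rewrite ler_wpM2r ?addr_ge0//.
  by rewrite /S; have := sqnorm_le_norm xM; lra.
rewrite /W; have -> : (1 + sqnorm (x - y)) `^ (- al) =
    S `^ al * (S * (1 + sqnorm (x - y))) `^ (- al).
  by apply: powR_cancel; rewrite ?addr_ge0.
rewrite ler_wpM2l ?powR_ge0//; apply: powRN_le => //; first exact: ltW.
by rewrite ltr_wpDr.
Qed.

Lemma bracket_le_enorm x : W x <= 2 `^ al / (1 + enorm x) `^ (2 * al).
Proof.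
have e0 := enorm_ge0 x; have s0 := sqnorm_ge0 x.
have H : (1 + enorm x) ^+ 2 / 2 <= 1 + sqnorm x.
  by rewrite -sqr_enorm; have := sqr_ge0 (1 - enorm x); lra.
have p0 : 0 < (1 + enorm x) ^+ 2 by rewrite exprn_gt0// ltr_wpDr.
have p02 : 0 < (1 + enorm x) ^+ 2 / 2 by rewrite divr_gt0.
apply: le_trans (powRN_le (ltW al0) p02 H) _.
rewrite powRM ?invr_ge0 ?(ltW p0)// mulrC.
have -> : (2 : R)^-1 `^ (- al) = 2 `^ al by rewrite powR_invN.
by rewrite powRN powRrM (powR_mulrn 2)// addr_ge0.
Qed.

Lemma bracket_le_norm x : W x <= (1 + `|x| ^+ 2) `^ (- al).
Proof.
apply: powRN_le; [exact: ltW|by rewrite ltr_wpDr// sqr_ge0|].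
by rewrite lerD2l sqr_norm_le.
Qed.

Lemma measurable_kernel : measurable_fun [set: 'rV[R]_n] kernel.
Proof.
have me := continuous_measurable_rV (@continuous_enorm R n).
exact: (measurableT_comp (measurable_powR (- (2 * al))) me).
Qed.

Lemma measurable_far_kernel : measurable_fun [set: 'rV[R]_n] far_kernel.
Proof. by apply: continuous_measurable_rV; exact: continuous_far_kernel. Qed.

Lemma measurable_near_kernel : measurable_fun [set: 'rV[R]_n] near_kernel.
Proof.
by apply: measurable_funB; [exact: measurable_kernel|exact: measurable_far_kernel].
Qed.

End kernels.

(** * The far part *)

Section far_part.
Context {R : realType} {n : nat}.
Variables (r al : R) (u : 'rV[R]_n -> R).
Hypothesis r0 : 0 < r.
Hypothesis al_n : n%:R < 2 * al.
Hypothesis Cu : Ck 1 u.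
Hypothesis u_growth : (\int[lebesgue_rV R n]_x
  (`|u x| `^ (r + 1) / (1 + enorm x) `^ (2 * al))%:E < +oo)%E.
Notation mu := (lebesgue_rV R n).
Notation "'d_ i" := ('D_(delta_mx ord0 i) u) (at level 10, i at level 9).
Implicit Types x y z : 'rV[R]_n.

Let al0 : 0 < al.
Proof. by have := ler0n R n; move: al_n; lra. Qed.

Definition far_integrand x y : R := sgnpow r (u x - u y) * far_kernel al (x - y).

Definition dfar_integrand (i : 'I_n) x y : R :=
  (r + 1) * `|u x - u y| `^ r * 'd_i x * far_kernel al (x - y) +
  sgnpow r (u x - u y) * dfar_kernel al i (x - y).

Let weight y : R := (1 + `|u y| `^ (r + 1)) * (1 + sqnorm y) `^ (- al).

Let mpow (a : R) (f : 'rV[R]_n -> R) : measurable_fun [set: 'rV[R]_n] f ->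
  measurable_fun [set: 'rV[R]_n] (fun x => f x `^ a).
Proof. by move=> mf; exact: (measurableT_comp (measurable_powR a) mf). Qed.

Let mnorm (f : 'rV[R]_n -> R) : measurable_fun [set: 'rV[R]_n] f ->
  measurable_fun [set: 'rV[R]_n] (fun x => `|f x|).
Proof. exact: measurableT_comp. Qed.

Let msq : measurable_fun [set: 'rV[R]_n] (@sqnorm R n).
Proof. by apply: continuous_measurable_rV; exact: continuous_sqnorm. Qed.

(** The constant 1 is handled by [integrable_bracket], the power of u by the
    growth hypothesis, which is the L_sp condition. *)
Lemma integrable_weight : mu.-integrable [set: 'rV[R]_n] (EFin \o weight).
Proof.
have mu1 : measurable_fun [set: 'rV[R]_n] (fun y => `|u y| `^ (r + 1)).
  by apply: mpow; apply: mnorm; exact: measurable_Ck Cu.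
have mW : measurable_fun [set: 'rV[R]_n] (fun y : 'rV[R]_n => (1 + sqnorm y) `^ (- al)).
  by apply: mpow; apply: measurable_funD.
have I1 : mu.-integrable [set: 'rV[R]_n] (EFin \o (fun y : 'rV[R]_n => (1 + sqnorm y) `^ (- al))).
  apply: integrable_dominated (integrable_bracket al_n) => // y.
  rewrite ger0_norm ?powR_ge0//; exact: bracket_le_norm.
have I2 : mu.-integrable [set: 'rV[R]_n]
    (EFin \o (fun y : 'rV[R]_n => `|u y| `^ (r + 1) / (1 + enorm y) `^ (2 * al))).
  apply: integrable_of_ge0 => //; last by move=> x; rewrite divr_ge0 ?powR_ge0.
  apply: measurable_funM => //.
  under eq_fun do rewrite -powRN.
  apply: mpow; apply: measurable_funD => //.
  by apply: continuous_measurable_rV; exact: continuous_enorm.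
have I3 := integrableD measurableT I1 (integrableZl measurableT (2 `^ al) I2).
apply: integrable_dominated I3.
  by apply: measurable_funM => //; exact: measurable_funD.
move=> y; rewrite /weight ger0_norm; last first.
  by rewrite mulr_ge0 ?addr_ge0 ?powR_ge0.
rewrite mulrDl mul1r lerD2l mulrCA ler_wpM2l ?powR_ge0//.
exact: bracket_le_enorm.
Qed.

Lemma far_integrand_dominated (M : R) :
  exists2 g : 'rV[R]_n -> R, mu.-integrable [set: 'rV[R]_n] (EFin \o g) &
    forall x y, `|x| <= M -> `|far_integrand x y| <= g y /\
      forall i, `|dfar_integrand i x y| <= g y.
Proof.
have [A A0 uA] := continuous_locally_bounded M (Ck_continuous Cu).
have [B B0 uB] := partials_locally_bounded M Cu.
have [c c0 kc] := far_kernel_translate_le (n := n) al0 M.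
have r10 : 0 <= r + 1 by rewrite addr_ge0// ltW.
have [c2 c20 Pc] : exists2 c2 : R, 0 <= c2 & forall x y, `|x| <= M ->
    `|u x - u y| `^ (r + 1) <= c2 * (1 + `|u y| `^ (r + 1)).
  exists (2 `^ (r + 1) * (A `^ (r + 1) + 1)).
    by rewrite mulr_ge0 ?addr_ge0 ?powR_ge0.
  by move=> x y xM; apply: normpow_sub_le => //; exact: uA.
pose K := c * (c2 + (r + 1) * (1 + c2) * B + 3 * al * c2).
exists (fun y => K * weight y).
  exact: (integrableZl measurableT K integrable_weight).
move=> x y xM.
have k0 : 0 < far_kernel al (x - y) := far_kernel_gt0 _ _.
have kW := kc x y xM.
set k := far_kernel al (x - y) in k0 kW *.
set W := (1 + sqnorm y) `^ (- al) in kW.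
have W0 : 0 <= W := powR_ge0 _ _.
set Q := 1 + `|u y| `^ (r + 1).
have Q1 : 1 <= Q by rewrite lerDl powR_ge0.
have P1 : `|u x - u y| `^ (r + 1) <= c2 * Q := Pc x y xM.
have P0 := powR_ge0 `|u x - u y| (r + 1).
have P2 : `|u x - u y| `^ r <= (1 + c2) * Q.
  apply: le_trans (normpow_le_succ _ (ltW r0)) _; rewrite mulrDl mul1r lerD//.
have P3 := powR_ge0 `|u x - u y| r.
have wE : weight y = Q * W by [].
have cW0 : 0 <= c * W by rewrite mulr_ge0.
have f1 : `|far_integrand x y| <= c2 * Q * (c * W).
  rewrite /far_integrand normrM norm_sgnpow ?(ltW r0)// (gtr0_norm k0).
  by apply: ler_pM => //; exact: ltW.
have K0 : 0 <= (r + 1) * (1 + c2) * B + 3 * al * c2.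
  have c21 : 0 <= 1 + c2 by rewrite addr_ge0.
  by apply: addr_ge0; rewrite !mulr_ge0 ?(ltW al0).
split.
  apply: le_trans f1 _; rewrite wE /K.
  have -> : c * (c2 + (r + 1) * (1 + c2) * B + 3 * al * c2) * (Q * W) =
    c2 * Q * (c * W) + ((r + 1) * (1 + c2) * B + 3 * al * c2) * (Q * (c * W)) by ring.
  by rewrite lerDl !mulr_ge0// (le_trans _ Q1).
move=> i; apply: le_trans (ler_normD _ _) _.
have f2 : `|sgnpow r (u x - u y) * dfar_kernel al i (x - y)| <= c2 * Q * (3 * al * (c * W)).
  rewrite normrM norm_sgnpow ?(ltW r0)//; apply: ler_pM => //.
  apply: le_trans (norm_dfar_kernel_le al0 i (x - y)) _.
  by rewrite ler_wpM2l// mulr_ge0// ltW.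
have f3 : `|(r + 1) * `|u x - u y| `^ r * 'd_i x * k| <= (r + 1) * ((1 + c2) * Q) * B * (c * W).
  rewrite !normrM (ger0_norm r10) (ger0_norm P3) (gtr0_norm k0).
  apply: ler_pM => //; rewrite ?mulr_ge0//; first exact: ltW.
  apply: ler_pM => //; rewrite ?mulr_ge0//; last exact: uB.
  by rewrite ler_wpM2l.
apply: le_trans (lerD f3 f2) _; rewrite wE /K.
have -> : c * (c2 + (r + 1) * (1 + c2) * B + 3 * al * c2) * (Q * W) =
  (r + 1) * ((1 + c2) * Q) * B * (c * W) + c2 * Q * (3 * al * (c * W))
   + c2 * (Q * (c * W)) by ring.
by rewrite lerDl !mulr_ge0// (le_trans _ Q1).
Qed.

Let cu : continuous u := Ck_continuous Cu.

Let cdu i : continuous ('d_i).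
Proof. exact: Ck_continuous (Ck_derive i Cu). Qed.

Lemma measurable_far_integrand x : measurable_fun [set: 'rV[R]_n] (far_integrand x).
Proof.
apply: continuous_measurable_rV; apply: continuous_mul.
  by apply: (continuous_sgnpow_sub r0) => //; exact: continuous_const.
by apply: continuous_comp_subl; exact: continuous_far_kernel.
Qed.

Lemma Ck1_far_integral : Ck 1 (fun x => \int[mu]_y far_integrand x y).
Proof.
apply: (@Ck1_parametric_integral R n _ _ mu far_integrand dfar_integrand).
- exact: measurable_far_integrand.
- move=> i x; apply: continuous_measurable_rV; apply: continuous_add; apply: continuous_mul.
  + apply: continuous_mul; last exact: continuous_const.
    apply: continuous_mul; first exact: continuous_const.
    by apply: (continuous_normpow_sub r0) => //; exact: continuous_const.
  + by apply: continuous_comp_subl; exact: continuous_far_kernel.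
  + by apply: (continuous_sgnpow_sub r0) => //; exact: continuous_const.
  + by apply: continuous_comp_subl; exact: continuous_dfar_kernel.
- move=> i x y.
  have d1 : is_derive x (delta_mx ord0 i) (fun x => sgnpow r (u x - u y))
      ((r + 1) * `|u x - u y| `^ r * 'd_i x).
    apply: is_derive_comp1; first exact: is_derive_sgnpow.
    have du : is_derive x (delta_mx ord0 i) u ('d_i x).
      by apply: derivableP; exact: (Ck_derivable Cu).
    by apply: is_derive_eq; rewrite subr0.
  have d2 := is_derive_translate (is_derive_far_kernel al i (x - y)).
  apply: is_derive_eq; rewrite /GRing.scale/= /dfar_integrand; ring.
- move=> y; apply: continuous_mul.
    by apply: (continuous_sgnpow_sub r0) => //; exact: continuous_const.
  by apply: (continuous_comp_addr (z := - y)); exact: continuous_far_kernel.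
- move=> i y; apply: continuous_add; apply: continuous_mul.
  + apply: continuous_mul; last exact: cdu.
    apply: continuous_mul; first exact: continuous_const.
    by apply: (continuous_normpow_sub r0) => //; exact: continuous_const.
  + by apply: (continuous_comp_addr (z := - y)); exact: continuous_far_kernel.
  + by apply: (continuous_sgnpow_sub r0) => //; exact: continuous_const.
  + by apply: (continuous_comp_addr (z := - y)); exact: continuous_dfar_kernel.
- exact: far_integrand_dominated.
Qed.

Lemma integrable_far_integrand x :
  mu.-integrable [set: 'rV[R]_n] (EFin \o far_integrand x).
Proof.
have [g ig fg] := far_integrand_dominated `|x|.
apply: integrable_dominated ig; first exact: measurable_far_integrand.
by move=> y; have [] := fg x y (lexx _).
Qed.

End far_part.

(** * The near part *)

Section near_part.
Context {R : realType} {n : nat}.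
Variables (r al : R) (u : 'rV[R]_n -> R).
Hypothesis r0 : 0 < r.
Hypothesis al0 : 0 < al.
Hypothesis q_al : 2 * al < n%:R + near_exponent r.
Hypothesis Cu : Ck 3 u.
Notation mu := (lebesgue_rV R n).
Notation "'d_ i" := ('D_(delta_mx ord0 i) u) (at level 10, i at level 9).
Implicit Types x y z : 'rV[R]_n.

Definition near_integrand x z : R :=
  (sgnpow r (u x - u (x + z)) + sgnpow r (u x - u (x - z))) * near_kernel al z.

Definition dnear_integrand (i : 'I_n) x z : R :=
  (r + 1) * (`|u x - u (x + z)| `^ r * ('d_i x - 'd_i (x + z)) +
             `|u x - u (x - z)| `^ r * ('d_i x - 'd_i (x - z))) * near_kernel al z.

(** A single constant serves for u and for all its partial derivatives, which are
    of class C^2. *)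
Lemma local_difference_bounds (M : R) : exists2 C : R, 0 <= C & forall x z,
  `|x| <= M -> `|z| < 1 ->
  [/\ `|u x - u (x + z)| <= C * `|z|, `|u x - u (x - z)| <= C * `|z|,
      `|(u x - u (x + z)) + (u x - u (x - z))| <= C * `|z| ^+ 2 &
      forall i, `|'d_i x - 'd_i (x - z)| <= C * `|z| /\
        `|('d_i x - 'd_i (x + z)) + ('d_i x - 'd_i (x - z))| <= C * `|z| ^+ 2].
Proof.
have H (f : 'rV[R]_n -> R) : Ck 2 f -> exists C : R, 0 <= C /\ forall x z,
    `|x| <= M -> `|z| < 1 ->
    [/\ `|f x - f (x + z)| <= C * `|z|, `|f x - f (x - z)| <= C * `|z| &
      `|(f x - f (x + z)) + (f x - f (x - z))| <= C * `|z| ^+ 2].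
  move=> Cf.
  (* Both x and z have to lie in the ball where the estimates hold. *)
  pose N := Num.max M 1.
  have [C1 C10 P1] := Ck1_locally_lipschitz N (CkW Cf).
  have [C2 C20 P2] := Ck2_second_difference N Cf.
  exists (C1 + C2); split; first exact: addr_ge0.
  move=> x z xM z1.
  have xN : `|x| <= N by rewrite le_max xM.
  have zN : `|z| <= N by rewrite le_max (ltW z1) orbT.
  have C1C (w : 'rV[R]_n) : C1 * `|w| <= (C1 + C2) * `|w| by rewrite ler_wpM2r// lerDl.
  split.
  - by rewrite distrC; exact: le_trans (P1 x z xN zN) (C1C z).
  - have := P1 x (- z) xN; rewrite normrN distrC => /(_ zN) h.
    exact: le_trans h (C1C z).
  - have -> : f x - f (x + z) + (f x - f (x - z)) =
      - (f (x + z) + f (x - z) - f x *+ 2) by rewrite mulr2n; ring.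
    rewrite normrN; apply: le_trans (P2 x z xN zN) _.
    by rewrite ler_wpM2r ?exprn_ge0// lerDr.
have [C0 [C00 P0]] := H u (CkW Cu).
have [C CP] := choice (fun i => H _ (Ck_derive i Cu)).
have Ci i : C i <= C0 + \sum_j C j.
  rewrite (bigD1 i)//= addrCA lerDl addr_ge0// sumr_ge0// => j _.
  by case: (CP j).
have S0 : C0 <= C0 + \sum_j C j by rewrite lerDl sumr_ge0// => j _; case: (CP j).
exists (C0 + \sum_j C j); first exact: le_trans C00 S0.
move=> x z xM z1; have [h1 h2 h3] := P0 x z xM z1.
split => [| | |i].
- by apply: le_trans h1 _; rewrite ler_wpM2r.
- by apply: le_trans h2 _; rewrite ler_wpM2r.
- by apply: le_trans h3 _; rewrite ler_wpM2r ?exprn_ge0.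
have [_ /(_ x z xM z1)[_ h5 h6]] := CP i.
split; first by apply: le_trans h5 _; rewrite ler_wpM2r.
by apply: le_trans h6 _; rewrite ler_wpM2r ?exprn_ge0.
Qed.

(** The numerator is O(|z|^q) with q = [near_exponent r] and the near kernel is
    O(|z|^(-2 al)), whence the integrable majorant |z|^(q - 2 al). At z = 0 the
    numerators vanish. *)
Lemma near_integrand_dominated (M : R) :
  exists2 g : 'rV[R]_n -> R, mu.-integrable [set: 'rV[R]_n] (EFin \o g) &
    forall x z, `|x| <= M -> `|near_integrand x z| <= g z /\
      forall i, `|dnear_integrand i x z| <= g z.
Proof.
have [C0 C00 CP] := local_difference_bounds M.
have [C1 C10 P] := second_difference_near r0 C00 C00.
have r10 : 1 <= r + 1 by rewrite lerDr ltW.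
have r10' : 0 <= r + 1 by exact: le_trans r10.
pose K := (r + 1) * C1 * (1 + 3 `^ al).
have K0 : 0 <= K by apply: mulr_ge0; [exact: mulr_ge0|rewrite addr_ge0 ?powR_ge0].
pose b := near_exponent r - 2 * al.
exists (fun z => K * near_power b z).
  have nb : - n%:R < b by rewrite /b; move: q_al; lra.
  exact: (integrableZl measurableT K (integrable_near_power nb)).
move=> x z xM.
have g0 : 0 <= K * near_power b z by rewrite mulr_ge0 ?near_power_ge0.
have [z1|z1] := ltP `|z| 1; last first.
  have k0 : near_kernel al z = 0.
    by apply: near_kernel_support; apply: le_trans (norm_le_enorm z).
  split; first by rewrite /near_integrand k0 mulr0 normr0.
  by move=> i; rewrite /dnear_integrand k0 mulr0 normr0.
have [->|z0] := eqVneq z 0.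
  have e : near_power b 0 >= 0 := near_power_ge0 b (0 : 'rV[R]_n).
  split => [|i].
    by rewrite /near_integrand subr0 addr0 subrr /sgnpow mulr0 addr0 mul0r normr0 mulr_ge0.
  by rewrite /dnear_integrand subr0 addr0 !subrr !mulr0 addr0 mulr0 mul0r normr0 mulr_ge0.
have t0 : 0 < `|z| by rewrite normr_gt0.
have t01 : 0 < `|z| <= 1 by rewrite t0 ltW.
have [h1 h2 h3 h4] := CP x z xM z1.
have gE : K * near_power b z =
    (r + 1) * (C1 * `|z| `^ near_exponent r) * ((1 + 3 `^ al) * `|z| `^ (- (2 * al))).
  rewrite /near_power z1 /b powRD; last by rewrite (gt_eqF t0) implybT.
  by rewrite /K; ring.
have kb := norm_near_kernel_le al0 z0 z1.
have q0 : 0 <= C1 * `|z| `^ near_exponent r by rewrite mulr_ge0 ?powR_ge0.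
rewrite gE; split => [|i].
  have z00 : `|0 : R| <= C0 * `|z| by rewrite normr0 mulr_ge0.
  have z01 : `|(0 + 0 : R)| <= C0 * `|z| ^+ 2 by rewrite addr0 normr0 mulr_ge0 ?exprn_ge0.
  have [f1 _] := P _ _ _ 0 0 t01 h1 h2 h3 z00 z01.
  rewrite /near_integrand normrM; apply: ler_pM => //.
  by apply: le_trans f1 _; rewrite ler_peMl.
have [h5 h6] := h4 i.
have [_ f2] := P _ _ _ _ _ t01 h1 h2 h3 h5 h6.
rewrite /dnear_integrand normrM; apply: ler_pM => //.
by rewrite normrM (ger0_norm r10') ler_wpM2l.
Qed.

Let cu : continuous u := Ck_continuous Cu.

Let cdu i : continuous ('d_i).
Proof. exact: Ck_continuous (Ck_derive i Cu). Qed.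

Lemma measurable_near_integrand x : measurable_fun [set: 'rV[R]_n] (near_integrand x).
Proof.
apply: measurable_funM; last exact: measurable_near_kernel.
apply: continuous_measurable_rV.
by apply: continuous_add; apply: (continuous_sgnpow_sub r0); [exact: continuous_const|exact: continuous_comp_addl|
  exact: continuous_const|exact: continuous_comp_subl].
Qed.

Lemma Ck1_near_integral : Ck 1 (fun x => \int[mu]_z near_integrand x z).
Proof.
apply: (@Ck1_parametric_integral R n _ _ mu near_integrand dnear_integrand).
- exact: measurable_near_integrand.
- move=> i x; apply: measurable_funM; last exact: measurable_near_kernel.
  apply: continuous_measurable_rV.
  apply: continuous_mul; first exact: continuous_const.
  apply: continuous_add; apply: continuous_mul.
  + by apply: (continuous_normpow_sub r0); [exact: continuous_const|exact: continuous_comp_addl].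
  + apply: continuous_sub; first exact: continuous_const.
    exact: (@continuous_comp_addl _ _ _ x (@cdu i)).
  + by apply: (continuous_normpow_sub r0); [exact: continuous_const|exact: continuous_comp_subl].
  + by apply: continuous_sub; [exact: continuous_const|exact: (@continuous_comp_subl _ _ _ x (@cdu i))].
- move=> i x z.
  have du y : is_derive y (delta_mx ord0 i) u ('d_i y).
    by apply: derivableP; exact: (Ck_derivable Cu).
  have d1 w : is_derive x (delta_mx ord0 i) (fun x => sgnpow r (u x - u (x - w)))
      ((r + 1) * `|u x - u (x - w)| `^ r * ('d_i x - 'd_i (x - w))).
    apply: is_derive_comp1; first exact: is_derive_sgnpow.
    have d2 := is_derive_translate (du (x - w)).
    by apply: is_derive_eq.
  have d3 := d1 z; have d4 := d1 (- z).
  have E y : y - - z = y + z by rewrite opprK.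
  have {}d4 : is_derive x (delta_mx ord0 i) (fun x => sgnpow r (u x - u (x + z)))
      ((r + 1) * `|u x - u (x + z)| `^ r * ('d_i x - 'd_i (x + z))).
    by move: d4; rewrite !E; under eq_fun do rewrite E.
  rewrite /near_integrand; apply: is_derive_eq.
  rewrite /GRing.scale/= /dnear_integrand; ring.
- move=> z; apply: continuous_mul; last exact: continuous_const.
  by apply: continuous_add; apply: (continuous_sgnpow_sub r0) => //; exact: continuous_comp_addr.
- move=> i z; apply: continuous_mul; last exact: continuous_const.
  apply: continuous_mul; first exact: continuous_const.
  apply: continuous_add; apply: continuous_mul.
  + by apply: (continuous_normpow_sub r0) => //; exact: continuous_comp_addr.
  + by apply: continuous_sub; [exact: cdu|exact: (@continuous_comp_addr _ _ _ _ (@cdu i))].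
  + by apply: (continuous_normpow_sub r0) => //; exact: continuous_comp_addr.
  + by apply: continuous_sub; [exact: cdu|exact: (@continuous_comp_addr _ _ _ _ (@cdu i))].
- exact: near_integrand_dominated.
Qed.

Lemma integrable_near_integrand x :
  mu.-integrable [set: 'rV[R]_n] (EFin \o near_integrand x).
Proof.
have [g ig fg] := near_integrand_dominated `|x|.
apply: integrable_dominated ig; first exact: measurable_near_integrand.
by move=> z; have [] := fg x z (lexx _).
Qed.

End near_part.

(** * Truncated integrals and regularity *)

Section truncation.
Context {R : realType} {n : nat}.
Notation mu := (lebesgue_rV R n).
Implicit Types x y z : 'rV[R]_n.

Lemma measurable_eball x (e : R) : measurable (eball x e).
Proof.
apply: open_measurable_rV.
have ce : continuous (fun y : 'rV[R]_n => enorm (y - x)).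
  exact: (@continuous_comp_addr R _ (@enorm R n) (- x) (@continuous_enorm R n)).
move/continuousP : ce => /(_ [set t : R | t < e]); apply; exact: open_lt.
Qed.

Lemma integrable_restrict_eballC (g : 'rV[R]_n -> R) x (e : R) :
  mu.-integrable [set: 'rV[R]_n] (EFin \o g) ->
  mu.-integrable (~` eball x e) (EFin \o g).
Proof.
move=> ig; apply: integrableS ig => //.
by apply: measurableC; exact: measurable_eball.
Qed.

Lemma Rintegral_flip_shift b x (f : 'rV[R]_n -> R) :
  mu.-integrable [set: 'rV[R]_n] (EFin \o f) ->
  \int[mu]_z f (flip_shift b x z) = \int[mu]_z f z.
Proof. by move=> fi; exact: (congr1 fine (integral_flip_shift b x fi)). Qed.

(** Dominated convergence; the condition g x = 0 makes the restrictions converge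
    at the center as well, so that no null set has to be discarded. *)
Lemma cvg_truncated_integral (g : 'rV[R]_n -> R) x :
  mu.-integrable [set: 'rV[R]_n] (EFin \o g) -> g x = 0 ->
  \int[mu]_(y in ~` eball x e) g y @[e --> 0^'+] --> \int[mu]_y g y.
Proof.
move=> ig gx; apply/cvg_at_rightP => w [w0 wcvg].
have mg : measurable_fun [set: 'rV[R]_n] g.
  by apply/measurable_EFinP; exact: measurable_int ig.
have mB e : measurable (~` eball x e) by apply: measurableC; exact: measurable_eball.
under eq_fun do rewrite Rintegral_mkcond.
apply: fine_cvg.
rewrite fineK; last exact: integrable_fin_num.
have mf k : measurable_fun [set: 'rV[R]_n] (EFin \o (g \_ (~` eball x (w k)))).
  apply/measurable_EFinP; apply/(measurable_restrictT g (mB (w k))).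
  exact: measurable_funTS.
have mg' : measurable_fun [set: 'rV[R]_n] (EFin \o g) by exact/measurable_EFinP.
have pt : {ae mu, forall y, [set: 'rV[R]_n] y ->
    (EFin \o (g \_ (~` eball x (w k)))) y @[k --> \oo] --> (EFin \o g) y}.
  apply/aeW => y _; apply: cvg_EFin; first exact: nearW.
  (* At y = x all terms vanish; at y <> x the sequence is eventually constant. *)
  have [->|yx] := eqVneq y x.
    apply: cvg_near_cst; apply: nearW => k /=.
    by rewrite patchE gx; case: ifP.
  have yx0 : 0 < enorm (y - x).
    by apply: lt_le_trans (norm_le_enorm _); rewrite normr_gt0 subr_eq0.
  apply: cvg_near_cst; near=> k; rewrite /= patchE mem_set//= /eball/=.
  apply/negP; rewrite -leNgt.
  near: k; move/cvgrPdist_lt : wcvg => /(_ _ yx0); apply: filterS => k.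
  by rewrite sub0r normrN gtr0_norm// => /ltW.
have bd : {ae mu, forall y k, [set: 'rV[R]_n] y ->
    (`|(EFin \o (g \_ (~` eball x (w k)))) y| <= `|(EFin \o g) y|)%E}.
  apply/aeW => y k _; rewrite lee_fin /= patchE.
  by case: ifP => // _; rewrite normr0.
have ig' := integrable_abse ig.
by have [_ _] := dominated_convergence measurableT mf mg' pt ig' bd.
Unshelve. all: end_near. Qed.

End truncation.

Section decomposition.
Context {R : realType} {n : nat}.
Variables (s p : R) (u : 'rV[R]_n -> R).
Let r := p - 2.
Let al := (n%:R + s * p) / 2.
Hypothesis r0 : 0 < r.
Hypothesis sp0 : 0 < s * p.
Hypothesis sp_q : s * p < near_exponent r.
Hypothesis Cu : Ck 3 u.
Hypothesis u_Lsp : Lsp s p u.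
Notation mu := (lebesgue_rV R n).
Implicit Types x y z : 'rV[R]_n.

Let al2 : 2 * al = n%:R + s * p.
Proof. by rewrite /al; field. Qed.

Let al_n : n%:R < 2 * al.
Proof. by rewrite al2 ltrDl. Qed.

Let al0 : 0 < al.
Proof. by have := ler0n R n; move: al_n; lra. Qed.

Let q_al : 2 * al < n%:R + near_exponent r.
Proof. by rewrite al2 ltrD2l. Qed.

Let u_growth : (\int[mu]_x
  (`|u x| `^ (r + 1) / (1 + enorm x) `^ (2 * al))%:E < +oo)%E.
Proof.
have [_] := u_Lsp; rewrite al2.
by have -> : p - 1 = r + 1 by rewrite /r; ring.
Qed.

Let Cu1 : Ck 1 u := CkW (CkW Cu).

Let near := near_integrand r al u.
Let far := far_integrand r al u.

Let I_far x : mu.-integrable [set: 'rV[R]_n] (EFin \o far x).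
Proof. exact: integrable_far_integrand. Qed.

Let I_near x : mu.-integrable [set: 'rV[R]_n] (EFin \o near x).
Proof. exact: integrable_near_integrand. Qed.

(** The near contribution at y before symmetrization: it is integrable away from
    x only, in contrast with [near_integrand]. *)
Definition one_sided x y : R := sgnpow r (u x - u y) * near_kernel al (x - y).

Lemma plap_integrandE x y : plap_integrand s p u x y = sgnpow r (u x - u y) * kernel al (x - y).
Proof. by rewrite /plap_integrand /kernel al2 powRN. Qed.

Lemma plap_integrand_split x y : plap_integrand s p u x y = one_sided x y + far x y.
Proof.
rewrite plap_integrandE /one_sided /far /far_integrand -mulrDr /near_kernel.
by rewrite subrK.
Qed.

Lemma measurable_sgnpow_diff x : measurable_fun [set: 'rV[R]_n] (fun y => sgnpow r (u x - u y)).
Proof.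
apply: continuous_measurable_rV.
apply: continuous_compose (continuous_sgnpow r0).
by apply: continuous_sub; [exact: continuous_const|exact: Ck_continuous Cu].
Qed.

Lemma measurable_plap_integrand x : measurable_fun [set: 'rV[R]_n] (plap_integrand s p u x).
Proof.
rewrite (funext (plap_integrandE x)).
apply: measurable_funM; first exact: measurable_sgnpow_diff.
apply: (measurableT_comp (measurable_kernel al)).
rewrite (_ : (fun y => x - y) = flip_shift true x); first exact: measurable_flip_shift.
by apply/funext => y; rewrite /flip_shift expr1 scaleN1r addrC.
Qed.

(** Off a ball the kernel is at most a multiple of the far kernel. *)
Lemma integrable_plap_integrand x e : 0 < e ->
  mu.-integrable (~` eball x e) (EFin \o plap_integrand s p u x).
Proof.
move=> e0; have [c c0 kc] := kernel_le_far (n := n) al0 e0.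
have I1 := integrable_restrict_eballC x e (integrableZl measurableT c (integrable_abse (I_far x))).
apply: le_integrable I1.
- by apply: measurableC; exact: measurable_eball.
- by apply/measurable_EFinP; apply: measurable_funTS; exact: measurable_plap_integrand.
- move=> y /= /negP; rewrite -leNgt => exy.
  rewrite lee_fin plap_integrandE /far /far_integrand/= (normrM c) normr_id.
  rewrite [in leLHS](normrM (sgnpow _ _)) (normrM (sgnpow _ _)) (ger0_norm c0).
  rewrite mulrCA ler_wpM2l//.
  rewrite (gtr0_norm (far_kernel_gt0 _ _)) ger0_norm ?powR_ge0//.
  by apply: kc; rewrite -enormN opprB.
Qed.

Lemma integrable_one_sided x e : 0 < e ->
  mu.-integrable (~` eball x e) (EFin \o one_sided x).
Proof.
move=> e0.
have mB : measurable (~` eball x e) by apply: measurableC; exact: measurable_eball.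
have := integrableB mB (integrable_plap_integrand x e0) (integrable_restrict_eballC x e (I_far x)).
congr (mu.-integrable _ _); apply/funext => y /=.
by rewrite -EFinB plap_integrand_split addrK.
Qed.

(** The left-hand side is computed twice, substituting y = x + z and y = x - z;
    the near kernel is even, and the average of the two results is the
    right-hand side. *)
Lemma truncated_near_integralE x e : 0 < e ->
  \int[mu]_(y in ~` eball x e) one_sided x y =
  2^-1 * \int[mu]_(z in ~` eball 0 e) near x z.
Proof.
move=> e0.
have mB y : measurable (~` eball y e) by apply: measurableC; exact: measurable_eball.
pose A y := if e <= enorm (y - x) then one_sided x y else 0.
have eballCE (w z : 'rV[R]_n) : (z \in ~` eball w e) = (e <= enorm (z - w)).
  by rewrite in_setC leNgt; congr (~~ _); apply/idP/idP; rewrite inE.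
have AE : one_sided x \_ (~` eball x e) = A.
  by apply/funext => y; rewrite /A patchE eballCE.
have IA : mu.-integrable [set: 'rV[R]_n] (EFin \o A).
  have := integrable_one_sided x e0.
  rewrite (integrable_mkcond _ (mB x)).
  congr (mu.-integrable _ _); apply/funext => y.
  by rewrite /A /= patchE eballCE /=; case: ifP.
have I1 := @integrable_flip_shift R n false x _ IA.
have I2 := @integrable_flip_shift R n true x _ IA.
have E1 : \int[mu]_z A (flip_shift false x z) = \int[mu]_y A y.
  exact: Rintegral_flip_shift IA.
have E2 : \int[mu]_z A (flip_shift true x z) = \int[mu]_y A y.
  exact: Rintegral_flip_shift IA.
rewrite [LHS]Rintegral_mkcond [in RHS]Rintegral_mkcond AE.
have half t : t = 2^-1 * (t + t) :> R by field.
have E3 := etrans (RintegralD measurableT I1 I2) (congr2 +%R E1 E2).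
apply: etrans (half _) _; congr (_ * _); apply: etrans (esym E3) _.
apply: eq_Rintegral => z _; rewrite /= patchE eballCE subr0 /A.
have -> : flip_shift false x z = x + z by rewrite /flip_shift expr0 scale1r addrC.
have -> : flip_shift true x z = x - z by rewrite /flip_shift expr1 scaleN1r addrC.
have -> : x + z - x = z by rewrite addrC addKr.
have -> : x - z - x = - z by rewrite addrAC subrr sub0r.
rewrite (enormN z); case: (e <= enorm z); last by rewrite addr0.
rewrite /near /near_integrand /one_sided mulrDl.
have -> : x - (x + z) = - z by rewrite opprD addrA subrr sub0r.
have -> : x - (x - z) = z by rewrite opprB addrC subrK.
by rewrite near_kernelN.
Qed.

Lemma plap_trunc_cvg x :
  plap_trunc s p u x e @[e --> 0^'+] -->
  2^-1 * \int[mu]_z near x z + \int[mu]_y far x y.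
Proof.
have nx : near x 0 = 0.
  by rewrite /near /near_integrand subr0 addr0 subrr /sgnpow mulr0 addr0 mul0r.
have fx : far x x = 0.
  by rewrite /far /far_integrand subrr /sgnpow mulr0 mul0r.
have cn := cvg_truncated_integral (I_near x) nx.
have cf := cvg_truncated_integral (I_far x) fx.
have L : 2^-1 * (\int[mu]_(z in ~` eball 0 e) near x z) +
    \int[mu]_(y in ~` eball x e) far x y @[e --> 0^'+] -->
    2^-1 * \int[mu]_z near x z + \int[mu]_y far x y.
  by apply: cvgD; [apply: cvgM; [exact: cvg_cst|exact: cn]|exact: cf].
apply: cvg_trans L; apply: near_eq_cvg; near=> e.
have e0 : 0 < e by near: e; exact: nbhs_right_gt.
have mB : measurable (~` eball x e) by apply: measurableC; exact: measurable_eball.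
have I1 := integrable_one_sided x e0.
have I2 := integrable_restrict_eballC x e (I_far x).
rewrite /plap_trunc -(truncated_near_integralE x e0).
apply: etrans (esym (RintegralD mB I1 I2)) _.
by apply: eq_Rintegral => y _; rewrite plap_integrand_split.
Unshelve. all: end_near. Qed.

Lemma frac_p_laplacianE C x : frac_p_laplacian C s p u x =
  C * 2^-1 * (\int[mu]_z near x z) + C * (\int[mu]_y far x y).
Proof.
rewrite /frac_p_laplacian (cvg_lim (@Rhausdorff R) (@plap_trunc_cvg x)).
by rewrite mulrDr mulrA.
Qed.

Lemma frac_p_laplacian_is_defined x : frac_p_laplacian_defined s p u x.
Proof.
split; first by move=> e e0; exact: integrable_plap_integrand.
by apply/cvg_ex; exists (2^-1 * (\int[mu]_z near x z) + \int[mu]_y far x y); exact: plap_trunc_cvg.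
Qed.

Lemma Ck1_frac_p_laplacian C : Ck 1 (frac_p_laplacian C s p u).
Proof.
have -> : frac_p_laplacian C s p u =
    (fun x => C * 2^-1 * (\int[mu]_z near x z) + C * (\int[mu]_y far x y)).
  by apply/funext => x; exact: frac_p_laplacianE.
by apply: Ck1_linear_combination; [exact: Ck1_near_integral|exact: Ck1_far_integral].
Qed.

End decomposition.

Theorem theorem1p2 (R : realType) (n : nat) (hn : (0 < n)%N)
    (s p : R) (hs : 0 < s < 1) (hp : 2 < p)
    (C : R) (hC : 0 < C) (u : 'rV[R]_n -> R)
    (huC3 : Ck 3 u) (huL : Lsp s p u)
    (hgradL : Lsp s p (fun x => enorm (gradient u x)))
    (hps : 3 / (2 - s) < p) :
  (forall x : 'rV[R]_n, frac_p_laplacian_defined s p u x) /\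
  Ck 1 (frac_p_laplacian C s p u).
Proof.
have /andP[s0 s1] := hs.
have r0 : 0 < p - 2 by rewrite subr_gt0.
have p0 : 0 < p by lra.
have sp0 : 0 < s * p by rewrite mulr_gt0.
have sp_q : s * p < near_exponent (p - 2).
  rewrite /near_exponent lt_min; apply/andP; split.
    have s2 : 0 < 2 - s by lra.
    by move: hps; rewrite ltr_pdivrMr//; lra.
  by rewrite subrK gtr_pMl.
split; first exact: frac_p_laplacian_is_defined.
exact: Ck1_frac_p_laplacian.
Qed.
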